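(* Let $k\in\mathbb N$, $k\ge2$, and let $E$ be a symmetric space with the Fatou property. If $E^d$ is compactly fully $k$-rotund, then $E$ is reflexive.
   Context: Let $I=[0,\alpha)$, $\alpha=1$ or $\alpha=\infty$, with Lebesgue measure $\mu$, and $L^0$ the set of (classes of) extended real valued measurable functions on $I$. A Banach function space $(E,\|\cdot\|_E)$ is a Banach lattice that is a sublattice of $L^0$ such that (1) if $x\in L^0$, $y\in E$, $|x|\le|y|$ a.e., then $x\in E$ and $\|x\|_E\le\|y\|_E$; (2) there is a strictly positive $x\in E$. $E^+=\{x\in E:x\ge0\}$; $S_E$ is the unit sphere. Fatou property: if $(x_n)\subset E^+$, $\sup_n\|x_n\|_E<\infty$ and $x_n\uparrow x\in L^0$, then $x\in E$ and $\|x_n\|_E\uparrow\|x\|_E$. For $x\in L^0$: $d_x(\lambda)=\mu\{s\in I:|x(s)|>\lambda\}$, $x^*(t)=\inf\{\lambda>0:d_x(\lambda)\le t\}$. A symmetric space is a Banach function space $E$ such that $x\in L^0$, $y\in E$, $d_x=d_y$ imply $x\in E$ and $\|x\|_E=\|y\|_E$. $E^d=\{x^*:x\in E\}$ (the cone of nonnegative decreasing elements). $E^d$ is compactly fully $k$-rotund if every sequence $(x_n)\subset S_E\cap E^d$ such that $\|\sum_{i=1}^k x_{n,i}\|_E\to k$ as $n\to\infty$ for any $k$ subsequences $(x_{n,1})_n,\dots,(x_{n,k})_n$ of $(x_n)$ forms a relatively compact set. $E$ is order continuous if for every $x\in E$ and every $(x_n)\subset E^+$ with $x_n\le|x|$ and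 $x_n\to0$ a.e. one has $\|x_n\|_E\to0$. The associate space is $E'=\{y\in L^0:\int_I|xy|\,d\mu<\infty\ \forall x\in E\}$ with norm $\sup\{\int_I|xy|\,d\mu:\|x\|_E\le1\}$. $E$ is reflexive if $E$ and $E'$ are both order continuous (for spaces with the Fatou property this is the usual Banach space reflexivity). *)

(* Defs.v *)
From HB Require Import structures.
From mathcomp Require Import all_boot all_order all_algebra.
From mathcomp Require Import all_classical all_reals all_analysis.
From mathcomp Require Import measurable_realfun.
Set Implicit Arguments.
Unset Strict Implicit.
Unset Printing Implicit Defensive.
Import Order.TTheory GRing.Theory Num.Theory.
Import numFieldNormedType.Exports.
Local Open Scope classical_set_scope.
Local Open Scope ring_scope.

(** Elements of L^0 are represented by functions [R -> \bar R] that are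
    measurable on [D] (the interval I); their values outside [D] are irrelevant
    and they are compared only almost everywhere on [D].  The library's
    [lebesgue_measure] lives on the Borel sets; since every Lebesgue measurable
    function is a.e. equal to a Borel one, the classes are the same. *)

Section FunctionSpaces.
Context {R : realType} (D : set R).

Local Notation mu := (@lebesgue_measure R).

Definition L0 : set (R -> \bar R) := [set x : R -> \bar R | measurable_fun D x].

Definition distribution_function (x : R -> \bar R) (l : R) : \bar R :=
  mu (D `&` [set s | (l%:E < `|x s|)%E]).

(** The infimum is taken in [\bar R], so it is [+oo] on the empty set. *)
Definition rearrangement (x : R -> \bar R) (t : R) : \bar R :=
  ereal_inf [set l%:E | l in
    [set l : R | 0 < l /\ (distribution_function x l <= t%:E)%E]].

(** A Banach space of elements of L^0 is given by an abstract Banach space [E]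
    and a map [f] sending a vector to a representative of its class; [f] is
    linear and injective modulo a.e. equality.  Linearity forces [f x] to be
    finite a.e.: in [\bar R], [+oo - oo = -oo], whereas [f (x - x)] must be
    0 a.e. *)
Definition belongs (E : Type) (f : E -> R -> \bar R) (x : R -> \bar R) (z : E) :=
  ae_eq mu D (f z) x.

Record banach_function_space (E : completeNormedModType R)
    (f : E -> R -> \bar R) : Prop := {
  bfs_L0 : forall x, L0 (f x) ;
  bfs_inj : forall x y, ae_eq mu D (f x) (f y) -> x = y ;
  bfs_add : forall x y,
    ae_eq mu D (f (x + y)) (fun t => (f x t + f y t)%E) ;
  bfs_scale : forall (a : R) x,
    ae_eq mu D (f (a *: x)) (fun t => (a%:E * f x t)%E) ;
  bfs_max : forall x y, exists z,
    belongs f (fun t => Order.max (f x t) (f y t)) z ;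
  bfs_min : forall x y, exists z,
    belongs f (fun t => Order.min (f x t) (f y t)) z ;
  bfs_ideal : forall (x : R -> \bar R) (y : E), L0 x ->
    {ae mu, forall t, D t -> (`|x t| <= `|f y t|)%E} ->
    exists2 z, belongs f x z & `|z| <= `|y| ;
  bfs_weak_unit : exists x, {ae mu, forall t, D t -> (0 < f x t)%E}
}.

Record symmetric_space (E : completeNormedModType R)
    (f : E -> R -> \bar R) : Prop := {
  sym_bfs : banach_function_space f ;
  sym_equimeasurable : forall (x : R -> \bar R) (y : E), L0 x ->
    distribution_function x =1 distribution_function (f y) ->
    exists2 z, belongs f x z & `|z| = `|y|
}.

Definition fatou_property (E : completeNormedModType R)
    (f : E -> R -> \bar R) : Prop :=
  forall (x_ : nat -> E) (x : R -> \bar R), L0 x ->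
    (forall n, {ae mu, forall t, D t -> (0 <= f (x_ n) t)%E}) ->
    has_ubound (range (fun n => `|x_ n|)) ->
    {ae mu, forall t, D t ->
       nondecreasing_seq (fun n => f (x_ n) t) /\
       (f (x_ n) t @[n --> \oo] --> x t)} ->
    exists z, [/\ belongs f x z,
      nondecreasing_seq (fun n => `|x_ n|) &
      `|x_ n| @[n --> \oo] --> `|z|].

Definition decreasing_cone (E : completeNormedModType R)
    (f : E -> R -> \bar R) : set E :=
  [set z | exists x, belongs f (rearrangement (f x)) z].

(** [V] with norm [N] and representatives [f]; stated for a subset [A] of [V]
    so as to apply both to [E] and to its associate space. *)
Definition order_continuous (V : Type) (A : set V)
    (f : V -> R -> \bar R) (N : V -> \bar R) : Prop :=
  forall (x : V) (x_ : nat -> V), A x -> (forall n, A (x_ n)) ->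
    (forall n, {ae mu, forall t, D t -> (0 <= f (x_ n) t)%E}) ->
    (forall n, {ae mu, forall t, D t -> (f (x_ n) t <= `|f x t|)%E}) ->
    {ae mu, forall t, D t -> f (x_ n) t @[n --> \oo] --> 0%E} ->
    N (x_ n) @[n --> \oo] --> 0%E.

Definition associate_space (E : completeNormedModType R)
    (f : E -> R -> \bar R) : set (R -> \bar R) :=
  [set y | L0 y /\
    forall x : E, (\int[mu]_(t in D) `|f x t * y t| < +oo)%E].

Definition associate_norm (E : completeNormedModType R)
    (f : E -> R -> \bar R) (y : R -> \bar R) : \bar R :=
  ereal_sup [set (\int[mu]_(t in D) `|f x t * y t|)%E | x in
    [set x : E | `|x| <= 1]].

Definition reflexive_space (E : completeNormedModType R)
    (f : E -> R -> \bar R) : Prop :=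
  order_continuous [set: E] f (fun x => `|x|%:E) /\
  order_continuous (associate_space f) id (associate_norm f).

End FunctionSpaces.

(** The convergence of the norms along every choice of [k] subsequences is a
    hypothesis on the sequence. *)
Definition compactly_fully_rotund (R : realType) (E : completeNormedModType R)
    (k : nat) (C : set E) : Prop :=
  forall x : nat -> E,
    (forall n, `|x n| = 1 /\ C (x n)) ->
    (forall s : 'I_k -> nat -> nat,
       (forall i, {homo s i : m n / (m < n)%N}) ->
       `|\sum_(i < k) x (s i n)| @[n --> \oo] --> (k%:R : R)) ->
    precompact (range x).

(* Main.v *)
(** Rotundity is used only to produce cluster points of sequences in the cone.

    Order continuity of [E].  Let [x] be in the cone.  Among finitely many heads
    x 1_[0,T) the sum dominates a multiple of the shortest one, so if the norms
    of the heads along a monotone sequence T_n tend to a > 0, the heads have a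
    cluster point.  Letting T_n decrease to 0 this point would be 0, which is
    absurd, so short heads of [x] have small norm; letting T_n increase to
    infinity the point is [x] (the norms converge by the Fatou property), so far
    tails of [x] have small norm.  If x_n <= |x| tends to 0 a.e., then
    (x_n)^* <= x^* 1_[0,1/m) + x^* 1_[p,oo) + eta 1_[0,p) for large n.

    Order continuity of E'.  Let y_n <= |y| tend to 0 a.e. and put
    W_n = sup_(m >= n) (y_m)^*, a decreasing function; W_n decreases to 0.  The
    functional J_n x, the integral of |x| W_n, is additive on the cone,
    nonincreasing in n, dominates the pairing with y_n by Hardy and Littlewood,
    and tends to 0 for fixed x.  If the norms of the J_n decreased to b > 0, unit
    ball elements x_n of the cone with J_n x_n -> b would satisfy
    |x_(n_1) + ... + x_(n_k)| >= k - o(1), since J_N is at least k b - o(1) at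
    this sum when N <= n_1, ..., n_k; they would have a cluster point z, and
    J_n z could not tend to 0.

    Dominated convergence for J_n needs the integral of x^* y^* to be finite.
    First, the level sets of y have finite measure: otherwise, on [0, oo), the
    means of n unit blocks would have norms bounded below and a cluster point,
    which must be 0.  Then x^* is transplanted to a function x' on the domain of
    y, with a distribution no larger than that of x, such that the integral of
    x' |y| is comparable to that of x^* y^*. *)

Require Import Defs.
From HB Require Import structures.
From mathcomp Require Import all_boot all_order all_algebra.
From mathcomp Require Import all_classical all_reals all_analysis.
From mathcomp Require Import measurable_realfun.
From mathcomp Require Import ring lra.
Set Implicit Arguments.
Unset Strict Implicit.
Unset Printing Implicit Defensive.
Import Order.TTheory GRing.Theory Num.Theory.
Import numFieldNormedType.Exports.
Local Open Scope classical_set_scope.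
Local Open Scope ring_scope.

(** * Decreasing rearrangements *)

Section ErealComparison.
Context {R : realType}.
Implicit Types a b : \bar R.

(** If b < a then [b] is finite, being nonnegative and below [a], and the level l = b contradicts
    the hypothesis. *)
Lemma lee_ltP a b : (0 <= b)%E ->
  (forall l : R, 0 <= l -> (l%:E < a)%E -> (l%:E < b)%E) -> (a <= b)%E.
Proof.
move=> b0 h; rewrite leNgt; apply/negP => ba.
have bfin : b \is a fin_num by rewrite ge0_fin_numE// (lt_le_trans ba)// leey.
have := h (fine b); rewrite fine_ge0// fineK// ltxx => /(_ isT ba).
by [].
Qed.

Lemma eqe_ltP a b : (0 <= a)%E -> (0 <= b)%E ->
  (forall l : R, 0 <= l -> (l%:E < a)%E = (l%:E < b)%E) -> a = b.
Proof.
move=> a0 b0 h; apply/eqP; rewrite eq_le.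
by apply/andP; split; apply: lee_ltP => // l l0; rewrite h.
Qed.

Lemma cvge_lt_eventually (u : nat -> \bar R) a b :
  u n @[n --> \oo] --> a -> (a < b)%E ->
  exists N, forall n, (N <= n)%N -> (u n < b)%E.
Proof.
move=> ua ab; have [N _ h] := ua _ (open_ereal_lt' ab).
by exists N => n /h.
Qed.

Lemma cvge0_eventually_le (u : nat -> \bar R) : (forall n, 0 <= u n)%E ->
  (forall e : R, 0 < e -> exists N, forall n, (N <= n)%N -> (u n <= e%:E)%E) ->
  u n @[n --> \oo] --> 0%E.
Proof.
move=> u0 ue; have ufin n e : (u n <= e%:E)%E -> u n \is a fin_num.
  by move=> h; rewrite ge0_fin_numE// (le_lt_trans h)// ltry.
apply/fine_cvgP; split.
  by have [N hN] := ue 1 ltr01; exists N => // n /= Nn; exact: ufin (hN n Nn).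
apply/cvgrPdist_le => e e0; have [N hN] := ue e e0.
exists N => // n /= Nn; rewrite sub0r normrN ger0_norm ?fine_ge0//.
by rewrite -lee_fin fineK; [exact: hN|exact: ufin (hN n Nn)].
Qed.

End ErealComparison.

Section AlmostEverywhereOn.
Context {R : realType} (D : set R).
Local Notation mu := (@lebesgue_measure R).
Implicit Types P Q S : R -> Prop.

Lemma ae_onW P : (forall t, D t -> P t) -> {ae mu, forall t, D t -> P t}.
Proof. by move=> h; apply: aeW => t; exact: h. Qed.

Lemma ae_on_imp P Q : (forall t, D t -> P t -> Q t) ->
  {ae mu, forall t, D t -> P t} -> {ae mu, forall t, D t -> Q t}.
Proof.
move=> PQ; apply: (@filterS _ (almost_everywhere mu)) => t h Dt.
exact: PQ (h Dt).
Qed.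

Lemma ae_on_imp2 P Q S : (forall t, D t -> P t -> Q t -> S t) ->
  {ae mu, forall t, D t -> P t} -> {ae mu, forall t, D t -> Q t} ->
  {ae mu, forall t, D t -> S t}.
Proof.
move=> PQS; apply: (@filterS2 _ (almost_everywhere mu)) => t h k Dt.
exact: PQS (h Dt) (k Dt).
Qed.

Lemma ae_on_imp3 P Q S (U : R -> Prop) :
  (forall t, D t -> P t -> Q t -> S t -> U t) ->
  {ae mu, forall t, D t -> P t} -> {ae mu, forall t, D t -> Q t} ->
  {ae mu, forall t, D t -> S t} -> {ae mu, forall t, D t -> U t}.
Proof.
move=> PQSU; apply: (@filterS3 _ (almost_everywhere mu)) => t h k l Dt.
exact: PQSU (h Dt) (k Dt) (l Dt).
Qed.

End AlmostEverywhereOn.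

(** * Initial segments of the half line *)

Section InitialSegments.
Context {R : realType}.
Local Notation mu := (@lebesgue_measure R).

Lemma le_lebesgue_measure (A B : set R) : measurable A -> measurable B ->
  A `<=` B -> (mu A <= mu B)%E.
Proof. by move=> mA mB AB; apply: le_measure; rewrite ?inE. Qed.

(** The length is an extended real, so that both choices of [D], and the superlevel sets within [D]
    of a decreasing rearrangement, are initial segments. *)
Definition initial_segment (T : \bar R) : set R :=
  [set t | 0 <= t /\ (t%:E < T)%E].

Lemma initial_segmentE (T : \bar R) : (0 <= T)%E ->
  initial_segment T =
    if T is r%:E then `[0, r[%classic else `[0, +oo[%classic.
Proof.
case: T => [r| |]//= _; apply/seteqP; split=> t;
  rewrite /initial_segment /= in_itv/= ?lte_fin ?ltry ?andbT.
- by case=> -> ->.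
- by move/andP.
- by case.
- by [].
Qed.

Lemma measurable_initial_segment (T : \bar R) :
  measurable (initial_segment T).
Proof.
have [T0|T0] := leP 0%E T.
  by rewrite initial_segmentE//; case: T T0 => *; exact: measurable_itv.
rewrite (_ : initial_segment T = set0)//.
apply/seteqP; split=> // t [t0 tT].
by have := lt_trans tT T0; rewrite lte_fin ltNge t0.
Qed.

Lemma lebesgue_measure_initial_segment (T : \bar R) : (0 <= T)%E ->
  mu (initial_segment T) = T.
Proof.
move=> T0; rewrite initial_segmentE//; case: T T0 => [r| |]// r0.
  rewrite lebesgue_measure_itv/= lte_fin oppr0 adde0.
  by move: r0; rewrite lee_fin le_eqVlt => /predU1P[<-|->//]; rewrite ltxx.
by rewrite lebesgue_measure_itv/= ltry oppr0 adde0.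
Qed.

Lemma initial_segmentI (S T : \bar R) :
  initial_segment S `&` initial_segment T = initial_segment (mine S T).
Proof.
apply/seteqP; split=> t.
  by move=> [[t0 tS] [_ tT]]; split=> //; rewrite lt_min tS.
by case=> t0; rewrite lt_min => /andP[].
Qed.

Lemma half_line_initial_segment (D : set R) :
  D = `[0, 1[%classic \/ D = `[0, +oo[%classic ->
  D = initial_segment (mu D).
Proof.
case=> ->; rewrite lebesgue_measure_itv/= ?lte_fin ?ltr01 ?ltry oppr0 adde0.
  by rewrite initial_segmentE// lee_fin.
by rewrite initial_segmentE.
Qed.

End InitialSegments.

Section Rearrangements.
Context {R : realType} (D : set R).
Hypothesis HD : D = `[0, 1[%classic \/ D = `[0, +oo[%classic.
Local Notation mu := (@lebesgue_measure R).
Local Notation d := (distribution_function D).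
Local Notation rearr := (rearrangement D).
Implicit Types (x y h : R -> \bar R) (l t : R).

Lemma measurable_interval : measurable D.
Proof. by case: HD => ->; exact: measurable_itv. Qed.
Let mD := measurable_interval.

Lemma mem_interval t : D t <-> 0 <= t /\ (t%:E < mu D)%E.
Proof. by rewrite {1}(half_line_initial_segment HD). Qed.

Lemma interval_ge0 t : D t -> 0 <= t.
Proof. by move/mem_interval => []. Qed.

Lemma interval_initial_segment (T : \bar R) :
  D `&` initial_segment T = initial_segment (mine (mu D) T).
Proof. by rewrite {1}(half_line_initial_segment HD) initial_segmentI. Qed.

Lemma interval_initial_segment_le (T : \bar R) : (T <= mu D)%E ->
  D `&` initial_segment T = initial_segment T.
Proof. by move=> TD; rewrite interval_initial_segment min_r. Qed.

Lemma measurable_superlevel x l : L0 D x ->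
  measurable (D `&` [set s | (l%:E < `|x s|)%E]).
Proof.
move=> mx; apply: emeasurable_fun_o_infty => //.
exact: measurableT_comp.
Qed.

Lemma distribution_ge0 x l : (0 <= d x l)%E.
Proof. exact: measure_ge0. Qed.

Lemma distribution_le x l : L0 D x -> (d x l <= mu D)%E.
Proof.
move=> mx; apply: le_measure; rewrite ?inE//; first exact: measurable_superlevel.
Qed.

Lemma distribution_nonincreasing x l l' : L0 D x -> l <= l' ->
  (d x l' <= d x l)%E.
Proof.
move=> mx ll'; apply: le_measure; rewrite ?inE//.
- exact: measurable_superlevel.
- exact: measurable_superlevel.
- by apply: setIS => s /=; apply: le_lt_trans; rewrite lee_fin.
Qed.

Lemma distribution_lt0 x l : l < 0 -> d x l = mu D.
Proof.
move=> l0; rewrite /distribution_function; congr (mu _).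
by apply/seteqP; split=> [s []//|s Ds]; split=> //=; rewrite (lt_le_trans _ (abse_ge0 _)).
Qed.

(** Continuity of the measure from below: the superlevel sets at l + 1/(n+1) increase to the one at
    [l]. *)
Lemma distribution_right_continuous x l (c : \bar R) : L0 D x ->
  (forall l', l < l' -> (d x l' <= c)%E) -> (d x l <= c)%E.
Proof.
move=> mx h.
pose F n := D `&` [set s | ((l + n.+1%:R^-1)%:E < `|x s|)%E].
have UF : \bigcup_n F n = D `&` [set s | (l%:E < `|x s|)%E].
  apply/seteqP; split=> [s [n _ [Ds /= ls]]|s [Ds /= ls]].
    by split=> //=; apply: le_lt_trans ls; rewrite lee_fin lerDl.
  suff [n hn] : exists n, ((l + n.+1%:R^-1)%:E < `|x s|)%E by exists n.
  move: ls; case: `|x s|%E => [r| |]//; last by exists 0%N; rewrite ltry.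
  rewrite lte_fin -subr_gt0 => /ltr_add_invr[n]; rewrite add0r => hn.
  by exists n; rewrite lte_fin -ltrBrDl.
have mF n : measurable (F n) by exact: measurable_superlevel.
have cF : (mu \o F) n @[n --> \oo] --> d x l.
  rewrite /distribution_function -UF; apply: nondecreasing_cvg_mu => //.
    exact: bigcupT_measurable.
  move=> n m nm; apply/subsetPset; apply: setIS => s /=; apply: le_lt_trans.
  by rewrite lee_fin lerD2l lef_pV2 ?posrE// ler_nat.
rewrite -(cvg_lim _ cF)//; apply: lime_le; first by apply/cvg_ex; eexists; exact: cF.
by apply: nearW => n; apply: h; rewrite ltrDl.
Qed.

Lemma rearrangement_ge0 x t : (0 <= rearr x t)%E.
Proof. by apply: le_ereal_inf_tmp => _ [l [l0 _] <-]; rewrite lee_fin ltW. Qed.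

(** Right continuity of the distribution function gives this Galois connection, through which
    rearrangements are handled from here on. *)
Lemma rearrangement_le x t l : L0 D x -> 0 <= l ->
  (rearr x t <= l%:E)%E = (d x l <= t%:E)%E.
Proof.
move=> mx l0; apply/idP/idP => [h|h].
  apply: distribution_right_continuous => // l' ll'.
  have /ereal_inf_lt[_ [l'' [_ dl''] <-]] : (rearr x t < l'%:E)%E.
    by apply: le_lt_trans h _; rewrite lte_fin.
  rewrite lte_fin => l''l'; apply: le_trans dl''.
  by apply: distribution_nonincreasing => //; exact: ltW.
(* The infimum ranges over positive levels only, so [l], which may be 0, is approached by
   [l + e]. *)
apply/lee_addgt0Pr => e e0; apply: ereal_inf_lbound.
exists (l + e) => //; split; first by rewrite ltr_wpDl.
apply: le_trans h; apply: distribution_nonincreasing => //.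
by rewrite lerDl ltW.
Qed.

Lemma rearrangement_gt x t l : L0 D x -> 0 <= l ->
  (l%:E < rearr x t)%E = (t%:E < d x l)%E.
Proof. by move=> mx l0; rewrite ltNge rearrangement_le// -ltNge. Qed.

Lemma eq_distribution_rearrangement x y : d x =1 d y -> rearr x = rearr y.
Proof. by move=> /funext xy; apply/funext => t; rewrite /rearrangement xy. Qed.

(** * Functions on [D] whose superlevel sets are initial segments of prescribed length *)

Section Profile.
Variables (h : R -> \bar R) (delta : R -> \bar R).
Hypothesis h0 : forall t, D t -> (0 <= h t)%E.
Hypothesis delta0 : forall l, 0 <= l -> (0 <= delta l <= mu D)%E.
Hypothesis hdelta : forall t l, D t -> 0 <= l ->
  (l%:E < h t)%E = (t%:E < delta l)%E.

Let superlevel l : 0 <= l ->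
  D `&` [set s | (l%:E < h s)%E] = initial_segment (delta l).
Proof.
move=> l0; have /andP[_ dD] := delta0 l0.
rewrite -(interval_initial_segment_le dD).
apply/seteqP; split=> t [Dt /=].
  by rewrite hdelta// => ht; split=> //; split=> //; exact: interval_ge0.
by case=> _ ht; split=> //=; rewrite hdelta.
Qed.

Lemma profile_measurable : measurable_fun D h.
Proof.
apply: (measurability (@ErealGenOInfty.G R)).
  exact: ErealGenOInfty.measurableE.
move=> _ [_ [l ->] <-]; rewrite preimage_itvoy.
have [l0|l0] := leP 0 l.
  by rewrite superlevel//; exact: measurable_initial_segment.
rewrite (_ : D `&` _ = D)//; apply/seteqP; split=> [s []//|s Ds].
by split=> //=; apply: lt_le_trans (h0 Ds).
Qed.

Lemma profile_distribution l : 0 <= l -> d h l = delta l.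
Proof.
move=> l0; rewrite /distribution_function.
rewrite (_ : _ `&` _ = initial_segment (delta l)).
  by rewrite lebesgue_measure_initial_segment//; case/andP: (delta0 l0).
rewrite -superlevel//; apply/seteqP; split=> t [Dt /=];
  by rewrite (gee0_abs (h0 Dt)) => ht; split.
Qed.

(** By [hdelta], [h] exceeds [l] at [t] exactly when t < delta l, and [delta] is the distribution
    function of [h]; so [h] and its rearrangement exceed the same levels. *)
Lemma profile_rearrangement t : D t -> rearr h t = h t.
Proof.
move=> Dt; apply: eqe_ltP; [exact: rearrangement_ge0|exact: h0|move=> l l0].
rewrite rearrangement_gt// ?profile_distribution ?hdelta//.
exact: profile_measurable.
Qed.

End Profile.

Lemma measurable_rearrangement x : L0 D x -> L0 D (rearr x).
Proof.
move=> mx; apply: (@profile_measurable _ (d x)).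
- by move=> *; exact: rearrangement_ge0.
- by move=> *; rewrite distribution_ge0 distribution_le.
- by move=> *; rewrite rearrangement_gt.
Qed.

Lemma distribution_rearrangement x : L0 D x -> d (rearr x) =1 d x.
Proof.
move=> mx l; have [l0|l0] := ltP l 0; first by rewrite !distribution_lt0.
apply: profile_distribution => //.
- by move=> *; exact: rearrangement_ge0.
- by move=> *; rewrite distribution_ge0 distribution_le.
- by move=> *; rewrite rearrangement_gt.
Qed.

Lemma rearrangementK x : L0 D x -> rearr (rearr x) = rearr x.
Proof.
by move=> mx; apply: eq_distribution_rearrangement; exact: distribution_rearrangement.
Qed.

Lemma le_rearrangement x y t : L0 D x -> L0 D y ->
  (forall l, 0 <= l -> (d x l <= d y l)%E) -> (rearr x t <= rearr y t)%E.
Proof.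
move=> mx my xy; apply: lee_ltP => [|l l0]; first exact: rearrangement_ge0.
by rewrite !rearrangement_gt// => /lt_le_trans; apply; exact: xy.
Qed.

Lemma ae_le_distribution x y l : L0 D x -> L0 D y ->
  {ae mu, forall t, D t -> (`|x t| <= `|y t|)%E} -> (d x l <= d y l)%E.
Proof.
move=> mx my [N [mN N0 xy]].
have mxl := measurable_superlevel l mx; have myl := measurable_superlevel l my.
apply: (@le_trans _ _ (mu ((D `&` [set s | (l%:E < `|y s|)%E]) `|` N))).
  apply: le_measure; rewrite ?inE//; first exact: measurableU.
  move=> t [Dt /= lx]; have [Nt|Nt] := pselect (N t); [by right|left].
  split=> //=; apply: (lt_le_trans lx); apply: contrapT => nxy.
  by apply: Nt; apply: xy => /= /(_ Dt).
by rewrite (le_trans (measureU2 _ _ _))//= N0 adde0.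
Qed.

Lemma ae_eq_distribution x y : L0 D x -> L0 D y -> ae_eq mu D x y ->
  d x =1 d y.
Proof.
move=> mx my xy l; apply/eqP; rewrite eq_le; apply/andP; split;
  apply: ae_le_distribution => //; apply: ae_on_imp xy => t _ ->; exact: lexx.
Qed.

End Rearrangements.

(** * Layer cake formula with a weight *)

Section LayerCake.
Local Open Scope ereal_scope.
Context d (T : measurableType d) (R : realType).
Variables (m : {sigma_finite_measure set T -> \bar R}) (D : set T).
Hypothesis mD : measurable D.
Local Notation mu := (@lebesgue_measure R).
Local Notation GR := (measurableTypeR R).

(** The subgraph of [h] over [D], above height 0. Integrating its indicator with weight [w] over the
    product in both orders yields the layer cake formula. *)
Let under (h : T -> \bar R) : set (T * GR) :=
  [set q : T * GR | (0 <= (q.2 : R))%R /\ (q.2 : R)%:E < (h \_ D) q.1].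
Let F (h w : T -> \bar R) (p : T * GR) : \bar R :=
  (w \_ D) p.1 * (\1_(under h) p)%:E.

Section LevelIntegrals.
Variables (h w : T -> \bar R).
Hypotheses (mh : measurable_fun D h) (mw : measurable_fun D w).
Hypotheses (h0 : forall t, D t -> 0 <= h t) (w0 : forall t, D t -> 0 <= w t).

Let F_ge0 p : 0 <= F h w p.
Proof.
by apply: mule_ge0; [exact: erestrict_ge0|rewrite lee_fin].
Qed.

Let measurable_F : measurable_fun setT (F h w).
Proof.
have mhD := (measurable_restrictT h mD).1 mh.
have mwD := (measurable_restrictT w mD).1 mw.
apply: emeasurable_funM.
  by apply: (@measurableT_comp _ _ _ _ _ _ (w \_ D) _ fst).
apply/measurable_EFinP/measurable_indic.
rewrite (_ : under h = [set q : T * GR | (0 <= (q.2 : R))%R] `&`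
    [set q : T * GR | 0 < (h \_ D) q.1 - (q.2 : R)%:E]); last first.
  apply/seteqP; split=> q; rewrite /under /= => -[q0].
    by move=> qh; split=> //=; rewrite EFinN sube_gt0.
  by rewrite EFinN sube_gt0 => qh; split.
apply: measurableI.
  have : measurable_fun setT (fun q : T * GR => (0 <= (q.2 : R))%R).
    exact: measurable_fun_ler.
  move=> /(_ measurableT [set true]); rewrite setTI => mm.
  exact: mm.
rewrite -[X in measurable X]setTI; apply: emeasurable_fun_o_infty => //.
apply: emeasurable_funB.
  by apply: (@measurableT_comp _ _ _ _ _ _ (h \_ D) _ fst).
by apply/measurable_EFinP; exact: measurable_snd.
Qed.

Let integral_under : \int[m]_(t in D) (h t * w t) =
  \int[mu]_l \int[m]_t F h w (t, l).
Proof.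
rewrite -(@fubini_tonelli _ _ _ _ _ m mu (F h w))//.
rewrite [LHS]integral_mkcond; apply: eq_integral => t _.
rewrite /F /= ge0_integralZl//=; first last.
- exact: erestrict_ge0.
- apply/measurable_EFinP.
  rewrite (_ : (fun x => _) = \1_(initial_segment ((h \_ D) t)))//.
  by apply: measurable_indic; exact: measurable_initial_segment.
rewrite (_ : (fun x => _) = (fun l => (\1_(initial_segment ((h \_ D) t)) l)%:E))//.
rewrite integral_indic//=; last exact: measurable_initial_segment.
rewrite setIT lebesgue_measure_initial_segment; last exact: erestrict_ge0.
by rewrite !patchE; case: ifPn => // _; rewrite ?mul0e// muleC.
Qed.

Let integral_F l : \int[m]_t F h w (t, l) =
  if (0 <= l)%R then \int[m]_(t in D `&` [set t | l%:E < h t]) w t else 0.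
Proof.
case: ifPn => l0; last first.
  rewrite integral0_eq// => t _; rewrite /F indicE memNset ?mule0//=.
  by case; rewrite (negbTE l0).
rewrite [RHS]integral_mkcond; apply: eq_integral => t _.
rewrite /F /= indicE !patchE; case: ifPn; rewrite ?inE/= => Dt; last first.
  rewrite mul0e memNset// => -[]; rewrite notin_setE in Dt.
  by move=> /Dt.
have [lh|lh] := boolP (l%:E < h t).
  by rewrite mem_set ?mule1 ?mem_set//; split => //; rewrite patchE mem_set.
rewrite memNset ?mule0 ?memNset//.
  by move=> [_] /=; apply/negP.
by move=> /= [_]; rewrite patchE mem_set//; exact/negP.
Qed.

Lemma layer_cake : \int[m]_(t in D) (h t * w t) =
  \int[mu]_(l in `[0%R, +oo[) \int[m]_(t in D `&` [set t | l%:E < h t]) w t.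
Proof.
rewrite integral_under [RHS]integral_mkcond; apply: eq_integral => l _.
by rewrite integral_F patchE mem_setE in_itv/= andbT.
Qed.

Lemma measurable_integral_superlevel : measurable_fun (`[0%R, +oo[ : set R)
  (fun l => \int[m]_(t in D `&` [set t | l%:E < h t]) w t).
Proof.
apply: (@eq_measurable_fun _ _ _ _ _ (fun l : GR => \int[m]_t F h w (t, l))).
  by move=> l; rewrite inE/= in_itv/= andbT integral_F => ->.
apply: measurable_funS (measurable_fun_fubini_tonelli_G _ _ _) => //.
Qed.

End LevelIntegrals.

End LayerCake.

Section LayerCakeComparison.
Local Open Scope ereal_scope.
Context d (T : measurableType d) (R : realType).
Variables (m : {sigma_finite_measure set T -> \bar R}) (A B : set T).
Hypotheses (mA : measurable A) (mB : measurable B).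

(** By the layer cake formula, both sides are integrals over the levels [l] of the quantities
    compared in the last hypothesis. *)
Lemma le_integralM_superlevel (f v g w : T -> \bar R) :
  measurable_fun A f -> measurable_fun A v ->
  measurable_fun B g -> measurable_fun B w ->
  (forall t, A t -> 0 <= f t) -> (forall t, A t -> 0 <= v t) ->
  (forall t, B t -> 0 <= g t) -> (forall t, B t -> 0 <= w t) ->
  (forall l : R, (0 <= l)%R ->
    \int[m]_(t in A `&` [set t | l%:E < f t]) v t <=
    \int[m]_(t in B `&` [set t | l%:E < g t]) w t) ->
  \int[m]_(t in A) (f t * v t) <= \int[m]_(t in B) (g t * w t).
Proof.
move=> mf mv mg mw f0 v0 g0 w0 fg.
rewrite !layer_cake//; apply: ge0_le_integral => //.
- by move=> l _; apply: integral_ge0 => t [At _]; exact: v0.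
- exact: measurable_integral_superlevel.
- exact: measurable_integral_superlevel.
- by move=> l /=; rewrite in_itv/= andbT; exact: fg.
Qed.

Lemma le_integral_superlevel (f g : T -> \bar R) :
  measurable_fun A f -> measurable_fun B g ->
  (forall t, A t -> 0 <= f t) -> (forall t, B t -> 0 <= g t) ->
  (forall l : R, (0 <= l)%R ->
    m (A `&` [set t | l%:E < f t]) <= m (B `&` [set t | l%:E < g t])) ->
  \int[m]_(t in A) f t <= \int[m]_(t in B) g t.
Proof.
move=> mf mg f0 g0 fg.
have -> : \int[m]_(t in A) f t = \int[m]_(t in A) (f t * cst 1 t).
  by apply: eq_integral => t _; rewrite mule1.
have -> : \int[m]_(t in B) g t = \int[m]_(t in B) (g t * cst 1 t).
  by apply: eq_integral => t _; rewrite mule1.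
apply: le_integralM_superlevel => // l l0.
rewrite !integral_cst ?mul1e//; last 2 first.
- exact: emeasurable_fun_o_infty.
- exact: emeasurable_fun_o_infty.
exact: fg.
Qed.

End LayerCakeComparison.

(** * The Hardy-Littlewood inequality *)

Section HardyLittlewood.
Context {R : realType} (D : set R).
Hypothesis HD : D = `[0, 1[%classic \/ D = `[0, +oo[%classic.
Local Notation mu := (@lebesgue_measure R).
Local Notation d := (distribution_function D).
Local Notation rearr := (rearrangement D).
Implicit Types (x y h : R -> \bar R).
Let mD := measurable_interval HD.

Lemma superlevel_rearrangement x (l : R) : L0 D x -> 0 <= l ->
  D `&` [set s | (l%:E < rearr x s)%E] = initial_segment (d x l).
Proof.
move=> mx l0.
rewrite -(interval_initial_segment_le HD (distribution_le HD l mx)).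
apply/seteqP; split=> t [Dt /=]; rewrite rearrangement_gt// => h.
  by split=> //; split=> //; exact: interval_ge0 Dt.
by case: h.
Qed.

(** Level by level: the part of [A] where |x| > l has measure at most the minimum of [mu A] and
    [d x l], which is exactly the length of the level set of the rearrangement on the initial
    segment. *)
Lemma integral_le_rearrangement x (A : set R) : L0 D x -> measurable A ->
  A `<=` D ->
  (\int[mu]_(t in A) `|x t| <= \int[mu]_(t in initial_segment (mu A)) rearr x t)%E.
Proof.
move=> mx mA AD.
have AD' : (mu A <= mu D)%E by apply: le_measure; rewrite ?inE.
have SD : initial_segment (mu A) `<=` D.
  by rewrite -(interval_initial_segment_le HD AD'); exact: subIsetl.
apply: le_integral_superlevel => //.
- exact: measurable_initial_segment.
- by apply: measurable_funS AD _ => //; exact: measurableT_comp.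
- by apply: measurable_funS SD _ => //; exact: measurable_rearrangement.
- by move=> t _; exact: rearrangement_ge0.
move=> l l0.
have -> : initial_segment (mu A) `&` [set t | (l%:E < rearr x t)%E] =
    initial_segment (mine (mu A) (d x l)).
  by rewrite -(setIidl SD) -setIA superlevel_rearrangement// initial_segmentI.
rewrite [leRHS]lebesgue_measure_initial_segment ?le_min ?measure_ge0//.
have mxl := measurable_superlevel HD l mx.
have mAl : measurable (A `&` [set t | (l%:E < `|x t|)%E]).
  by rewrite -(setIidl AD) -setIA; exact: measurableI.
by apply/andP; split; apply: le_measure; rewrite ?inE//; exact: setSI.
Qed.

(** The layer cake formula in [x] leaves, at each level, the integral of |y| over a superlevel set
    of [x]; rearranging turns this set into the initial segment of the same measure. *)
Lemma hardy_littlewood x y : L0 D x -> L0 D y ->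
  (\int[mu]_(t in D) `|x t * y t| <= \int[mu]_(t in D) (rearr x t * rearr y t))%E.
Proof.
move=> mx my.
under eq_integral do rewrite abseM.
apply: le_integralM_superlevel => //.
- exact: measurableT_comp.
- exact: measurableT_comp.
- exact: measurable_rearrangement.
- exact: measurable_rearrangement.
- by move=> *; exact: rearrangement_ge0.
- by move=> *; exact: rearrangement_ge0.
move=> l l0; rewrite superlevel_rearrangement//.
by apply: integral_le_rearrangement => //; exact: measurable_superlevel.
Qed.

End HardyLittlewood.

(** * Resonance *)

Section Transplant.
Context {R : realType} (D : set R).
Hypothesis HD : D = `[0, 1[%classic \/ D = `[0, +oo[%classic.
Local Notation mu := (@lebesgue_measure R).
Local Notation d := (distribution_function D).
Local Notation rearr := (rearrangement D).
Let mD := measurable_interval HD.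

(** * Transplanting a rearrangement along a weight with null level sets *)

Section InjectiveWeight.
Variable w : R -> R.
Hypothesis mw : measurable_fun setT w.
Hypothesis w0 : forall t, 0 <= w t.
Hypothesis w_inj : forall s t, D s -> D t -> 0 < w s -> w s = w t -> s = t.
Local Notation W := (EFin \o w).
Hypothesis dw : forall l, 0 < l -> (d W l < +oo)%E.

Let mW : L0 D W.
Proof. by apply/measurable_EFinP; exact: measurable_funTS. Qed.

Let dwE l : d W l = mu (D `&` [set s | l < w s]).
Proof.
congr (mu _); apply/seteqP; split=> s [Ds /=];
  by rewrite ?(ger0_norm (w0 s)) lte_fin.
Qed.

Let mwgt l : measurable (D `&` [set s | l < w s]).
Proof.
have := measurable_superlevel HD l mW; congr measurable.
by apply/seteqP; split=> s [Ds /=]; rewrite (ger0_norm (w0 s)) lte_fin.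
Qed.

Let mwge l : measurable (D `&` [set s | l <= w s]).
Proof.
have -> : [set s | l <= w s] = [set s | (l%:E <= W s)%E].
  by apply/seteqP; split=> s /=; rewrite lee_fin.
exact: emeasurable_fun_c_infty.
Qed.

(** By [w_inj] a positive value of [w] is taken in [D] at most once, and a point is null. *)
Let level_null l : 0 < l -> mu (D `&` [set s | l <= w s]) = d W l.
Proof.
move=> l0; apply/eqP; rewrite eq_le; apply/andP; split; last first.
  rewrite dwE; apply: le_lebesgue_measure => //.
  by apply: setIS => s /=; exact: ltW.
have [[s [Ds ws]]|nos] := pselect (exists s, D s /\ w s = l).
  apply: (@le_trans _ _ (mu ((D `&` [set s | l < w s]) `|` [set s]))).
    apply: le_lebesgue_measure => //; first exact: measurableU.
    move=> t [Dt /=]; rewrite le_eqVlt => /predU1P[lt|lt]; last by left.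
    by right; rewrite /= (@w_inj t s)// ?ws -?lt.
  apply: le_trans (measureU2 mu (mwgt l) (measurable_set1 s)) _.
  by rewrite [X in (_ + X)%E](lebesgue_measure_set1 s) adde0 dwE lexx.
rewrite dwE; apply: le_lebesgue_measure => // => s [Ds /=].
rewrite le_eqVlt => /predU1P[lt|//].
by exfalso; apply: nos; exists s.
Qed.

Let dw_cvg0 (T : \bar R) : (0 < T)%E -> exists2 l, 0 < l & (d W l < T)%E.
Proof.
move=> T0; pose F n := D `&` [set s | n.+1%:R < w s].
have F0 : \bigcap_n F n = set0.
  rewrite -subset0 => s /= Fs.
  have [_ /= h] := Fs (Num.truncn (w s)) I.
  by have := truncnS_gt (w s); rewrite ltNge (ltW h).
have cF : (mu \o F) n @[n --> \oo] --> 0%E.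
  rewrite -(measure0 mu) -F0; apply: nonincreasing_cvg_mu => //.
  - by have := @dw 1 ltr01; rewrite dwE.
  - by move=> n; exact: mwgt.
  - by rewrite F0.
  - move=> n m nm; apply/subsetPset; apply: setIS => s /=.
    by apply: le_lt_trans; rewrite ler_nat.
have [n /(_ n (leqnn n))] := cvge_lt_eventually cF T0.
by rewrite /= /F -dwE => h; exists n.+1%:R.
Qed.

(** The points of largest weight: up to a null set, a superlevel set of [w] of measure [T], or the
    whole set where w > 0 if that has measure at most [T]. *)
Definition transplant_domain (T : \bar R) : set R :=
  D `&` [set s | 0 < w s /\ (d W (w s) < T)%E].
Local Notation S := transplant_domain.

Let measurable_domain T : measurable (S T).
Proof.
pose V := [set v : R | 0 < v /\ (d W v < T)%E].
have mV : measurable V.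
  apply: is_interval_measurable => a b [a0 aT] [b0 bT] c /andP[ac cb].
  split; first exact: lt_le_trans ac.
  by apply: le_lt_trans aT; exact: distribution_nonincreasing.
have := mw measurableT mV; rewrite setTI => mwV.
exact: measurableI.
Qed.

(** The threshold is the infimum of the levels v > 0 with d W v < T. The distribution function is
    right continuous, and also left continuous at c > 0 because positive levels have no mass; hence
    it equals [T] there. *)
Let threshold (T : \bar R) : (0 < T)%E -> exists c, [/\ 0 <= c,
  (d W c <= T)%E, (0 < c -> (T <= d W c)%E) & forall s, D s ->
  (c < w s -> S T s) /\ (S T s -> c <= w s)].
Proof.
move=> T0; pose V := [set v : R | 0 < v /\ (d W v < T)%E].
have [v0 v00 v0T] := dw_cvg0 T0.
have Vlb : lbound V 0 by move=> v [v_gt0 _]; exact: ltW.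
have infV : has_inf V by split; [exists v0|exists 0].
pose c := inf V.
have c0 : 0 <= c by apply: lb_le_inf => //; exists v0.
have Vc l : c < l -> (d W l < T)%E.
  move=> /inf_lt -/(_ infV.1)[v [v_gt0 vT] vl].
  by apply: le_lt_trans vT; apply: distribution_nonincreasing => //; exact: ltW.
exists c; split=> //.
- by apply: distribution_right_continuous => // l cl; apply: ltW; exact: Vc.
- move=> c_gt0; rewrite -level_null//.
  (* The levels c - c/(n+2) increase to [c] and stay positive, where [dw] gives finite measure;
     being below the infimum, each of them has distribution at least [T]. *)
  pose F n := D `&` [set s | c - c / n.+2%:R < w s].
  have ltc n : c / n.+2%:R < c.
    by rewrite ltr_pdivrMr// ltr_pMr// ltr1n.
  have FI : \bigcap_n F n = D `&` [set s | c <= w s].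
    apply/seteqP; split=> s.
      move=> Fs; split; first by have [] := Fs 0%N I.
      rewrite /= leNgt; apply/negP => wc.
      have : 0 < (c - w s) / c by rewrite divr_gt0// subr_gt0.
      move=> /ltr_add_invr[n]; rewrite add0r => hn.
      have [_ /=] := Fs n I; apply/negP; rewrite -leNgt.
      rewrite lerBrDl -lerBrDr; apply: (@le_trans _ _ (c / n.+1%:R)).
        by rewrite ler_pM2l// lef_pV2 ?posrE// ler_nat.
      by move: (ltW hn); rewrite ler_pdivlMr// mulrC.
    move=> [Ds /= cs] n _; split=> //=; apply: lt_le_trans cs.
    by rewrite ltrBlDr ltrDl divr_gt0.
  have cF : (mu \o F) n @[n --> \oo] --> mu (D `&` [set s | c <= w s]).
    rewrite -FI; apply: nonincreasing_cvg_mu => //.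
    - have h : 0 < c - c / 2 by rewrite subr_gt0 (ltc 0%N).
      by have := dw h; rewrite dwE.
    - by move=> n; exact: mwgt.
    - by rewrite FI; exact: mwge.
    - move=> n m nm; apply/subsetPset; apply: setIS => s /=.
      apply: le_lt_trans; rewrite lerD2l lerN2 ler_pM2l//.
      by rewrite lef_pV2 ?posrE// ler_nat.
  rewrite -(cvg_lim _ cF)//; apply: lime_ge.
    by apply/cvg_ex; eexists; exact: cF.
  apply: nearW => n; rewrite /= /F -dwE leNgt; apply/negP => h.
  have : c <= c - c / n.+2%:R.
    by apply: ge_inf; [exists 0|split=> //; rewrite subr_gt0].
  by rewrite leNgt ltrBlDr ltrDl divr_gt0.
- move=> s Ds; split=> [cs|[_ [ws0 wsT]]].
    by split=> //; split; [exact: le_lt_trans cs|exact: Vc].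
  by apply: ge_inf; [exists 0|split].
Qed.

Let measure_domain_le T : (0 <= T)%E -> (mu (S T) <= T)%E.
Proof.
rewrite le_eqVlt => /predU1P[<-|T0].
  rewrite (_ : S 0%E = set0) ?measure0// -subset0 => s [_ [_]].
  by rewrite ltNge distribution_ge0.
have [c [c0 dcT _ cS]] := threshold T0.
apply: le_trans dcT; move: c0; rewrite le_eqVlt => /predU1P[<-|c0].
  rewrite dwE; apply: le_lebesgue_measure => //.
  by move=> s [Ds [ws _]]; split.
rewrite -level_null//; apply: le_lebesgue_measure => //.
by move=> s Ss; have [Ds _] := Ss; split=> //=; exact: (cS _ Ds).2.
Qed.

(** With [c] the threshold of [T], the set contains the superlevel set of [w] at the maximum of [c]
    and [nu], whose measure is at least [T] when nu < c and equals [d W nu] otherwise. *)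
Let measure_domain_superlevel T nu : (0 <= T)%E -> 0 <= nu ->
  (mine T (d W nu) <= mu (S T `&` [set s | (nu < w s)%R]))%E.
Proof.
rewrite le_eqVlt => /predU1P[<-|T0] nu0; first by rewrite ge_min measure_ge0.
have [c [c0 dcT Tdc cS]] := threshold T0.
have mSn : measurable (S T `&` [set s | (nu < w s)%R]).
  have -> : S T `&` [set s | (nu < w s)%R] = S T `&` (D `&` [set s | (nu < w s)%R]).
    by apply/seteqP; split=> s [[Ds Ss]] //= [].
  exact: measurableI.
apply: (@le_trans _ _ (d W (Num.max c nu))).
  have [nuc|cnu] := ltP nu c.
    by rewrite ge_min Tdc// (le_lt_trans nu0).
  by rewrite ge_min lexx orbT.
rewrite dwE; apply: le_lebesgue_measure => // => s [Ds /=].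
rewrite gt_max => /andP[cs nus]; split=> //.
exact: (cS _ Ds).1.
Qed.

(* Off the zeros of [w] the level sets of [w] are points, so composing u^* with
   the distribution function of [w] and with [w] recovers the level sets of u^*
   up to measure. *)
Lemma transplant (u : R -> \bar R) : L0 D u -> exists x : R -> \bar R,
  [/\ L0 D x, forall t, (0 <= x t)%E, forall l, 0 <= l -> (d x l <= d u l)%E &
    (\int[mu]_(t in D) (rearr u t * rearr W t) <=
     \int[mu]_(t in D) (x t * W t))%E].
Proof.
move=> mu_.
(* The point [s] gets the value of the rearrangement at its rank, the measure of the set where [w]
   is larger; this rank is finite by [dw], so [fine] loses nothing. *)
pose x s := if 0 < w s then rearr u (fine (d W (w s))) else 0%E.
have x0 t : (0 <= x t)%E by rewrite /x; case: ifP => // _; exact: rearrangement_ge0.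
have xS l : 0 <= l -> D `&` [set s | (l%:E < x s)%E] = S (d u l).
  move=> l0; apply/seteqP; split=> s [Ds /=].
    rewrite /x; case: ifP => [ws|_]; last by rewrite lte_fin ltNge l0.
    rewrite rearrangement_gt// fineK ?ge0_fin_numE ?distribution_ge0 ?dw//.
  case=> ws h; split=> //=; rewrite /x ws rearrangement_gt//.
  by rewrite fineK// ge0_fin_numE ?distribution_ge0 ?dw.
have mx : L0 D x.
  apply: (measurability _ (ErealGenOInfty.measurableE R)).
  move=> _ [_ [l ->] <-]; rewrite preimage_itvoy.
  have [l0|l0] := leP 0 l; first by rewrite xS.
  rewrite (_ : D `&` _ = D)//; apply/seteqP; split=> [s []//|s Ds].
  by split=> //=; apply: lt_le_trans (x0 s).
exists x; split=> //.
  move=> l l0; rewrite /distribution_function.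
  rewrite (_ : _ `&` _ = S (d u l)); first exact/measure_domain_le/distribution_ge0.
  rewrite -xS//; apply/seteqP; split=> s [Ds /=]; by rewrite gee0_abs.
apply: le_integralM_superlevel => //.
- exact: measurable_rearrangement.
- exact: measurable_rearrangement.
- by move=> *; exact: rearrangement_ge0.
- by move=> *; exact: rearrangement_ge0.
- by move=> *; rewrite lee_fin.
move=> l l0; rewrite superlevel_rearrangement// xS//.
have dD := distribution_le HD l mu_.
have SD : initial_segment (d u l) `<=` D.
  by rewrite -(interval_initial_segment_le HD dD); exact: subIsetl.
have SD' : S (d u l) `<=` D by exact: subIsetl.
(* The layer cake formula again, now over the levels [nu] of the weight, so that only measures of
   sets remain to be compared. *)
apply: le_integral_superlevel => //.
- exact: measurable_initial_segment.
- exact: measurable_domain.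
- by apply: measurable_funS SD _ => //; exact: measurable_rearrangement.
- exact: measurable_funS SD' _.
- by move=> t _; exact: rearrangement_ge0.
- by move=> *; rewrite lee_fin.
move=> nu nu0.
have -> : initial_segment (d u l) `&` [set t | (nu%:E < rearr W t)%E] =
    initial_segment (mine (d u l) (d W nu)).
  by rewrite -(setIidl SD) -setIA superlevel_rearrangement// initial_segmentI.
rewrite [leLHS]lebesgue_measure_initial_segment ?le_min ?distribution_ge0//.
apply: le_trans (measure_domain_superlevel _ nu0) _; first exact: distribution_ge0.
exact: lexx.
Qed.

End InjectiveWeight.

End Transplant.

(** * A perturbation that makes a function injective off its zeros *)

Section Spreading.
Context {R : realType}.

(** A positive [v] is rounded up to an integer power of e and multiplied by a factor in which [t] is
    encoded injectively, so that for t >= 0 no positive value is taken twice. *)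
Definition spread (v t : R) : R :=
  if 0 < v then expR (Num.ceil (ln v))%:~R * (1 + expR (- t)) else 0.

Let spread_factor (t : R) : 0 <= t -> 1 < 1 + expR (- t) <= 2.
Proof.
move=> t0; rewrite ltrDl expR_gt0/= -[leRHS]/(1 + 1) lerD2l.
by rewrite -expR0 ler_expR oppr_le0.
Qed.

Lemma spread_ge0 v t : 0 <= spread v t.
Proof.
by rewrite /spread; case: ifP.
Qed.

(** Rounding up to a power of e costs at most a factor e, and 1 + exp(-t) at most a factor 2. *)
Lemma spread_bounds v t : 0 <= v -> 0 <= t ->
  v <= spread v t <= 2 * expR 1 * v.
Proof.
move=> v0 t0; rewrite /spread; case: ltP => [v_gt0|vle0]; last first.
  have -> : v = 0 by apply/eqP; rewrite eq_le v0 vle0.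
  by rewrite mulr0 lexx.
have c1 : v <= expR (Num.ceil (ln v))%:~R.
  by rewrite -{1}(lnK v_gt0) ler_expR ceil_ge.
have c2 : expR (Num.ceil (ln v))%:~R <= expR 1 * v.
  rewrite -{2}(lnK v_gt0) -expRD ler_expR.
  have /andP[+ _] := ceil_itv (ln v).
  by rewrite intrD ltrBlDr addrC => /ltW.
have /andP[f1 f2] := spread_factor t0.
apply/andP; split; first by apply: (le_trans c1); rewrite ler_peMr ?expR_ge0// ltW.
rewrite -mulrA [leRHS]mulrC; exact: ler_pM.
Qed.

(* The two factors of [spread] separate: the first is an integer power of e and
   the second lies in ]1, 2], an interval contained in ]1, e[. *)
Lemma spread_inj u v s t : 0 <= s -> 0 <= t ->
  0 < spread u s -> spread u s = spread v t -> s = t.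
Proof.
move=> s0 t0 us0 usvt; have := us0; rewrite usvt; move: us0 usvt.
rewrite /spread; case: ifP => [_|]; last by rewrite ltxx.
case: ifP => [_|]; last by rewrite ltxx.
move: (Num.ceil (ln u)) (Num.ceil (ln v)) => i j _ + _.
have two_e : 2 <= expR 1 :> R by exact: expR_ge1Dx.
have lt_step (a b : int) (f g : R) : 1 < f <= 2 -> 1 < g <= 2 -> (a < b)%R ->
    expR a%:~R * f < expR b%:~R * g.
  move=> /andP[f1 f2] /andP[g1 g2] ab.
  apply: (@le_lt_trans _ _ (expR b%:~R)); last by rewrite ltr_pMr// expR_gt0.
  apply: (@le_trans _ _ (expR a%:~R * expR 1)).
    by rewrite ler_pM2l ?expR_gt0//; exact: le_trans two_e.
  by rewrite -expRD ler_expR -(intrD _ a 1) ler_int lezD1.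
have [ij|ji|<-] := ltgtP i j.
- by have /lt_eqF/eqP := lt_step i j _ _ (spread_factor s0) (spread_factor t0) ij.
- by have /gt_eqF/eqP := lt_step j i _ _ (spread_factor t0) (spread_factor s0) ji.
have e0 : expR i%:~R != 0 :> R by rewrite gt_eqF ?expR_gt0.
by move/(mulfI e0)/addrI/expR_inj/oppr_inj.
Qed.

Lemma measurable_spread (g : R -> R) : measurable_fun setT g ->
  measurable_fun setT (fun t => spread (g t) t).
Proof.
move=> mg; apply: measurable_fun_ifT => //.
  exact: measurable_fun_ltr.
have mc : measurable_fun setT (fun v : R => (Num.ceil v)%:~R : R).
  apply: nondecreasing_measurable => // a b ab.
  by rewrite ler_int; exact: le_ceil.
apply: measurable_funM.
  apply: measurableT_comp; first exact: measurable_expR.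
  apply: (measurableT_comp mc).
  by apply: measurableT_comp => //; exact: measurable_ln.
apply: measurable_funD => //.
apply: measurableT_comp; first exact: measurable_expR.
exact: measurable_funN.
Qed.

End Spreading.

(** * Resonance for general functions *)

Section Resonance.
Context {R : realType} (D : set R).
Hypothesis HD : D = `[0, 1[%classic \/ D = `[0, +oo[%classic.
Local Notation mu := (@lebesgue_measure R).
Local Notation d := (distribution_function D).
Local Notation rearr := (rearrangement D).
Let mD := measurable_interval HD.

Lemma distribution_scale (c : R) (x : R -> \bar R) l : 0 < c ->
  d (fun t => c%:E * x t)%E l = d x (c^-1 * l).
Proof.
move=> c0; rewrite /distribution_function; congr (mu _).
apply/seteqP; split=> t [Dt /=] h; split=> //=; move: h;
  by rewrite abseM /= gtr0_norm// EFinM lte_pdivrMl.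
Qed.

Lemma rearrangement_scale (c : R) (x : R -> \bar R) t : L0 D x -> 0 < c ->
  rearr (fun t => c%:E * x t)%E t = (c%:E * rearr x t)%E.
Proof.
move=> mx c0; apply: eqe_ltP => [||l l0].
- exact: rearrangement_ge0.
- by rewrite mule_ge0 ?rearrangement_ge0// lee_fin ltW.
rewrite rearrangement_gt//; last exact: measurable_funeM.
rewrite distribution_scale// -rearrangement_gt//; last by rewrite mulr_ge0// invr_ge0 ltW.
by rewrite EFinM lte_pdivrMl.
Qed.

(* Splitting the atoms of [y] by [spread] costs a factor 2e. *)
Lemma resonance (y u : R -> \bar R) : L0 D y -> L0 D u ->
  {ae mu, forall t, D t -> (`|y t| < +oo)%E} ->
  (forall l, 0 < l -> (d y l < +oo)%E) ->
  exists x : R -> \bar R, [/\ L0 D x, forall t, (0 <= x t)%E,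
    forall l, 0 <= l -> (d x l <= d u l)%E &
    (\int[mu]_(t in D) (rearr u t * rearr y t) <=
     (2 * expR 1)%:E * \int[mu]_(t in D) `|x t * y t|)%E].
Proof.
move=> my mu_ yfin dy.
pose g t := fine `|(y \_ D) t|.
have mg : measurable_fun setT g.
  apply: measurableT_comp => //; apply: measurableT_comp => //.
  exact/(measurable_restrictT _ mD).
have g0 t : 0 <= g t by exact: fine_ge0.
have gy : {ae mu, forall t, D t -> `|y t|%E = (g t)%:E}.
  apply: ae_on_imp yfin => t Dt yt.
  by rewrite /g patchE mem_set// fineK// ge0_fin_numE.
(* Almost everywhere on [D], [w] lies between |y| and 2e |y|, and its positive values are taken
   once, as [transplant] requires. *)
pose w t := spread (g t) t.
have mw : measurable_fun setT w by exact: measurable_spread.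
have w0 t : 0 <= w t by exact: spread_ge0.
have w_inj s t : D s -> D t -> 0 < w s -> w s = w t -> s = t.
  by move=> /(interval_ge0 HD) s0 /(interval_ge0 HD) t0; exact: spread_inj.
pose c : R := 2 * expR 1.
have c0 : 0 < c by rewrite mulr_gt0// expR_gt0.
have mW : L0 D (EFin \o w) by apply/measurable_EFinP; exact: measurable_funTS.
have yw : {ae mu, forall t, D t -> (`|y t| <= `|(EFin \o w) t|)%E}.
  apply: ae_on_imp gy => t Dt ->.
  have /andP[gw _] := spread_bounds (g0 t) (interval_ge0 HD Dt).
  by rewrite gee0_abs/= ?lee_fin// w0.
have wy : {ae mu, forall t, D t -> (w t)%:E <= c%:E * `|y t|}%E.
  apply: ae_on_imp gy => t Dt ->.
  have /andP[_ wg] := spread_bounds (g0 t) (interval_ge0 HD Dt).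
  by rewrite -EFinM lee_fin.
have dw l : 0 < l -> (d (EFin \o w) l < +oo)%E.
  move=> l0; apply: (@le_lt_trans _ _ (d (fun t => c%:E * y t)%E l)).
    apply: ae_le_distribution => //; first exact: measurable_funeM.
    apply: ae_on_imp wy => t Dt h.
    by rewrite abseM [`|c%:E|%E]gee0_abs ?lee_fin ?(ltW c0)// gee0_abs ?lee_fin.
  by rewrite distribution_scale//; apply: dy; rewrite mulr_gt0// invr_gt0.
have [x [mx x0 xu ux]] := transplant HD mw w0 w_inj dw mu_.
exists x; split=> //.
apply: (@le_trans _ _ (\int[mu]_(t in D) (rearr u t * rearr (EFin \o w) t))%E).
  apply: ge0_le_integral => //.
  - by move=> t _; rewrite mule_ge0// rearrangement_ge0.
  - by apply: emeasurable_funM; exact: measurable_rearrangement.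
  - by apply: emeasurable_funM; exact: measurable_rearrangement.
  - move=> t _; apply: lee_wpmul2l; first exact: rearrangement_ge0.
    by apply: le_rearrangement => // l l0; exact: ae_le_distribution.
apply: (le_trans ux).
rewrite -ge0_integralZl//.
- apply: ae_ge0_le_integral => //.
  + by move=> t _; rewrite mule_ge0// lee_fin.
  + exact: emeasurable_funM.
  + apply: measurable_funeM; apply: measurableT_comp => //.
    exact: emeasurable_funM.
  apply: ae_on_imp wy => t Dt h.
  rewrite abseM [`|x t|%E]gee0_abs// muleCA.
  exact: lee_wpmul2l.
- by apply: measurableT_comp => //; exact: emeasurable_funM.
Qed.

End Resonance.

(** * Symmetric spaces with a rotund cone *)

Section SymmetricSpaces.
Context {R : realType} (D : set R).
Hypothesis HD : D = `[0, 1[%classic \/ D = `[0, +oo[%classic.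
Local Notation mu := (@lebesgue_measure R).
Local Notation d := (distribution_function D).
Local Notation rearr := (rearrangement D).
Context (E : completeNormedModType R) (f : E -> R -> \bar R).
Hypothesis symE : symmetric_space D f.
Let mD := measurable_interval HD.
Let bfsE := sym_bfs symE.
Implicit Types (x y z : E) (g h : R -> \bar R) (A B : set R).

Lemma rep_measurable x : L0 D (f x).
Proof. exact: bfs_L0 bfsE x. Qed.

Lemma rep_inj x y : ae_eq mu D (f x) (f y) -> x = y.
Proof. exact: bfs_inj. Qed.

Lemma rep0 : ae_eq mu D (f 0) (cst 0%E).
Proof.
have := bfs_scale bfsE 0 0; rewrite scale0r; apply: ae_on_imp => t _ ->.
by rewrite mul0e.
Qed.

Lemma rep_eq0 x : ae_eq mu D (f x) (cst 0%E) -> x = 0.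
Proof.
by move=> x0; apply: rep_inj; apply: ae_on_imp2 x0 rep0 => t _ -> ->.
Qed.

Lemma repB x y : ae_eq mu D (f (x - y)) (fun t => (f x t - f y t)%E).
Proof.
have := bfs_scale bfsE (-1) y; rewrite scaleN1r => hy.
apply: ae_on_imp2 (bfs_add bfsE x (- y)) hy => t _ -> ->.
by rewrite EFinN mulN1e.
Qed.

Lemma rep_sum (I : Type) (s : seq I) (P : pred I) (F : I -> E) :
  ae_eq mu D (f (\sum_(i <- s | P i) F i))
             (fun t => (\sum_(i <- s | P i) f (F i) t)%E).
Proof.
elim: s => [|i s IH].
  by rewrite big_nil; apply: ae_on_imp rep0 => t _ ->; rewrite big_nil.
rewrite big_cons; case: ifPn => Pi.
  apply: ae_on_imp2 (bfs_add bfsE (F i) (\sum_(j <- s | P j) F j)) IH => t _ -> ->.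
  by rewrite big_cons Pi.
by apply: ae_on_imp IH => t _ ->; rewrite big_cons (negbTE Pi).
Qed.

Lemma norm_le x y : {ae mu, forall t, D t -> (`|f x t| <= `|f y t|)%E} ->
  `|x| <= `|y|.
Proof.
move=> /(bfs_ideal bfsE (rep_measurable x))[z xz].
by rewrite (rep_inj (x := z) (y := x)).
Qed.

Lemma rep_equimeasurable g y : L0 D g -> d g =1 d (f y) ->
  exists2 z, belongs D f g z & `|z| = `|y|.
Proof. exact: sym_equimeasurable. Qed.

Lemma norm_equimeasurable x y : d (f x) =1 d (f y) -> `|x| = `|y|.
Proof.
move=> /(rep_equimeasurable (rep_measurable x))[z xz <-].
by rewrite (rep_inj (x := z) (y := x)).
Qed.

Lemma rep_star x : exists z, [/\ ae_eq mu D (f z) (rearr (f x)), `|z| = `|x| &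
  decreasing_cone D f z].
Proof.
have mx := rep_measurable x.
have [z zx zn] := rep_equimeasurable (measurable_rearrangement HD mx)
  (distribution_rearrangement HD mx).
by exists z; split=> //; exists x.
Qed.

(** Between rearrangements the inequality of distributions is pointwise, so the ideal property
    applies; symmetry then passes from the rearrangement back to [g]. *)
Lemma rep_distribution_le g y : L0 D g ->
  (forall l, 0 <= l -> (d g l <= d (f y) l)%E) ->
  exists2 z, belongs D f g z & `|z| <= `|y|.
Proof.
move=> mg gy; have my := rep_measurable y.
have [y' [y'E <- _]] := rep_star y.
have mg' := measurable_rearrangement HD mg.
have [z' z'E z'y] : exists2 z, belongs D f (rearr g) z & `|z| <= `|y'|.
  apply: (bfs_ideal bfsE mg'); apply: ae_on_imp y'E => t _ ->.
  by rewrite !gee0_abs ?rearrangement_ge0//; exact: le_rearrangement.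
have [z gz zE] : exists2 z, belongs D f g z & `|z| = `|z'|.
  apply: rep_equimeasurable => // l; rewrite -(distribution_rearrangement HD mg).
  apply: ae_eq_distribution => //; first exact: rep_measurable.
  by apply: ae_on_imp z'E => t _ ->.
by exists z => //; rewrite zE.
Qed.

Lemma norm_distribution_le x y :
  (forall l, 0 <= l -> (d (f x) l <= d (f y) l)%E) -> `|x| <= `|y|.
Proof.
move=> /(rep_distribution_le (rep_measurable x))[z xz].
by rewrite (rep_inj (x := z) (y := x)).
Qed.

Lemma cone_rearrangement z h : L0 D h -> ae_eq mu D (f z) h ->
  (forall t, D t -> rearr h t = h t) -> decreasing_cone D f z.
Proof.
move=> mh zh hh; exists z; apply: ae_on_imp (zh) => t Dt ->; rewrite -hh//.
have -> // : rearr h = rearr (f z).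
apply: eq_distribution_rearrangement; apply: ae_eq_distribution => //.
  exact: rep_measurable.
by apply: ae_on_imp zh => s _ ->.
Qed.

(** For measurable [A] the ideal property supplies an element representing the product with the
    indicator, so the default of [xget] matters only for other sets. *)
Definition restr A x : E := xget 0 (belongs D f (f x \_ A)).

Lemma restrE A x : measurable A -> ae_eq mu D (f (restr A x)) (f x \_ A).
Proof.
move=> mA; rewrite /restr; case: xgetP => [z -> //|/(_ _)].
have mxA : L0 D (f x \_ A).
  apply/(measurable_restrict (f x) mA mD).
  by apply: measurable_funS (rep_measurable x) => //; exact: subIsetl.
have [|z zE _] := bfs_ideal bfsE mxA (y := x); last by move/(_ z).
apply: ae_onW => t Dt; rewrite patchE; case: ifPn => // _.
by rewrite abse0.
Qed.

Lemma restrB A x y : measurable A -> restr A (x - y) = restr A x - restr A y.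
Proof.
move=> mA; apply: rep_inj.
have h1 : ae_eq mu D (f (restr A (x - y))) ((fun t => f x t - f y t)%E \_ A).
  by apply: ae_on_imp2 (restrE (x - y) mA) (repB x y) => t _ ->; rewrite !patchE => ->.
have h2 : ae_eq mu D (f (restr A x - restr A y))
    (fun t => (f x \_ A) t - (f y \_ A) t)%E.
  by apply: ae_on_imp3 (repB (restr A x) (restr A y)) (restrE x mA)
    (restrE y mA) => t _ -> -> ->.
apply: ae_on_imp2 h1 h2 => t _ -> ->; rewrite !patchE.
by case: ifP => // _; rewrite sube0.
Qed.

Lemma restrI A B x : measurable A -> measurable B ->
  restr A (restr B x) = restr (A `&` B) x.
Proof.
move=> mA mB; apply: rep_inj.
apply: ae_on_imp3 (restrE (restr B x) mA) (restrE x mB)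
  (restrE x (measurableI _ _ mA mB)) => t _ h1 h2 ->.
rewrite h1 !patchE h2 !patchE in_setI.
by case: (t \in A).
Qed.

Lemma norm_restr_le A x : measurable A -> `|restr A x| <= `|x|.
Proof.
move=> mA; apply: norm_le; apply: ae_on_imp (restrE x mA) => t _ ->.
by rewrite patchE; case: ifP => // _; rewrite abse0.
Qed.

Lemma restrC A x : measurable A -> x - restr A x = restr (~` A) x.
Proof.
move=> mA; apply/eqP; rewrite subr_eq; apply/eqP/rep_inj.
apply: ae_on_imp3 (bfs_add bfsE (restr (~` A) x) (restr A x)) (restrE x mA)
  (restrE x (measurableC mA)) => t _ -> -> ->.
by rewrite !patchE in_setC; case: (t \in A); rewrite ?adde0 ?add0e.
Qed.

Lemma restr_set0 x : restr set0 x = 0.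
Proof.
by apply: rep_eq0; apply: ae_on_imp (restrE x measurable0) => t _ ->; rewrite patchE in_set0.
Qed.

(** Serves to identify cluster points, by looking at their restrictions to countably many sets that
    cover almost all of [D]. *)
Lemma restr_bigcup0 (A : (set R)^nat) x : (forall n, measurable (A n)) ->
  {ae mu, forall t, D t -> exists n, A n t} ->
  (forall n, restr (A n) x = 0) -> x = 0.
Proof.
move=> mA DA x0; apply: rep_eq0.
have : {ae mu, forall t, forall n, D t -> (f x \_ (A n)) t = 0%E}.
  apply: ae_foralln => n.
  by apply: ae_on_imp2 (restrE x (mA n)) rep0 => t _ <-; rewrite x0.
apply: (@filterS2 _ (almost_everywhere mu)) DA => t DA h Dt.
have [n Ant] := DA Dt.
by have := h n Dt; rewrite patchE mem_set.
Qed.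

Lemma restr_subset A B x : measurable A -> measurable B -> A `<=` B ->
  {ae mu, forall t, D t -> (0 <= f x t)%E} ->
  {ae mu, forall t, D t -> (0 <= f (restr A x) t <= f (restr B x) t)%E}.
Proof.
move=> mA mB AB; apply: ae_on_imp3 (restrE x mA) (restrE x mB) => t _ -> -> x0.
rewrite !patchE; have [/set_mem tA|tA] := boolP (t \in A).
  by rewrite mem_set ?x0 ?lexx//; exact: AB.
by rewrite lexx/=; case: ifP.
Qed.

Lemma norm_sum_le (k : nat) (u v : 'I_k -> E) :
  (forall i, {ae mu, forall t, D t -> (0 <= f (u i) t <= f (v i) t)%E}) ->
  `|\sum_i u i| <= `|\sum_i v i|.
Proof.
move=> uv; apply: norm_le.
have uv' : {ae mu, forall t, D t -> forall i, (0 <= f (u i) t <= f (v i) t)%E}.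
  have := @filter_forall _ _ _ (almost_everywhere mu) (ae_filter_ringOfSetsType mu) uv.
  by apply: (@filterS _ (almost_everywhere mu)) => t h Dt i; exact: h.
apply: ae_on_imp3 (rep_sum (index_enum 'I_k) predT u)
  (rep_sum (index_enum 'I_k) predT v) uv' => t _ -> -> h.
rewrite !gee0_abs; first (by apply: lee_sum => i _; case/andP: (h i));
  apply: sume_ge0 => i _; case/andP: (h i) => // h1 h2.
exact: le_trans h2.
Qed.

Lemma cone_ge0 x : decreasing_cone D f x ->
  {ae mu, forall t, D t -> (0 <= f x t)%E}.
Proof.
by case=> y; apply: ae_on_imp => t _ ->; exact: rearrangement_ge0.
Qed.

Lemma cone_scale c x : 0 < c -> decreasing_cone D f x ->
  decreasing_cone D f (c *: x).
Proof.
move=> c0 [y xy]; have my := rep_measurable y.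
exists (c *: y); apply: ae_on_imp2 (bfs_scale bfsE c x) xy => t _ -> ->.
rewrite -rearrangement_scale//.
suff -> : rearr (fun t => c%:E * f y t)%E = rearr (f (c *: y)) by [].
apply: eq_distribution_rearrangement; apply: ae_eq_distribution => //.
- exact: measurable_funeM.
- exact: rep_measurable.
- by apply: ae_on_imp (bfs_scale bfsE c y) => s _ ->.
Qed.

(** Cutting at [T] replaces the length of each superlevel set by its minimum with [T], so these sets
    remain initial segments. *)
Lemma cone_restr x (T : \bar R) : (0 <= T)%E -> decreasing_cone D f x ->
  decreasing_cone D f (restr (initial_segment T) x).
Proof.
move=> T0 [y xy]; have my := rep_measurable y.
have mS := measurable_initial_segment T.
pose h := rearr (f y) \_ (initial_segment T).
have h0 t : D t -> (0 <= h t)%E.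
  by move=> _; apply: erestrict_ge0 => s _; exact: rearrangement_ge0.
pose delta l := mine T (d (f y) l).
have delta0 l : 0 <= l -> (0 <= delta l <= mu D)%E.
  move=> l0; rewrite le_min T0 distribution_ge0/= ge_min.
  by rewrite distribution_le ?orbT.
have hd t l : D t -> 0 <= l -> (l%:E < h t)%E = (t%:E < delta l)%E.
  move=> Dt l0; rewrite lt_min /h patchE -rearrangement_gt//.
  have [tT|tT] := boolP (t%:E < T)%E.
    by rewrite mem_set//; split=> //; exact: interval_ge0 Dt.
  rewrite memNset; first by rewrite lte_fin ltNge l0.
  by case=> _; apply/negP.
apply: (@cone_rearrangement _ h).
- exact: profile_measurable h0 delta0 hd.
- apply: ae_on_imp2 (restrE x mS) xy => t _ ->.
  by rewrite /h !patchE => ->.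
- exact: profile_rearrangement h0 delta0 hd.
Qed.

(** * Cluster points from rotundity *)

Section Rotundity.
Variable k : nat.
Hypothesis rotE : compactly_fully_rotund k (decreasing_cone D f).

(** A lower bound uniform over all choices of [k] large indices covers all choices of [k]
    subsequences, because a strictly increasing [s i] satisfies n <= s i n. *)
Lemma rotund_cluster_unit (x : nat -> E) :
  (forall n, `|x n| = 1 /\ decreasing_cone D f (x n)) ->
  (forall e, 0 < e -> exists N, forall n : 'I_k -> nat,
    (forall i, (N <= n i)%N) -> k%:R - e <= `|\sum_i x (n i)|) ->
  exists z, forall e, 0 < e -> forall N, exists2 n, (N <= n)%N & `|x n - z| < e.
Proof.
move=> x1 xsum.
have : precompact (range x).
  apply: rotE => // s s_inc.
  have sn i n : (n <= s i n)%N.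
    elim: n => // n IH; apply: (leq_ltn_trans IH); exact: s_inc.
  apply/cvgrPdist_le => e e0; have [N hN] := xsum e e0.
  exists N => // n /= Nn.
  have le_k : `|\sum_(i < k) x (s i n)| <= k%:R.
    apply: le_trans (ler_norm_sum _ _ _) _.
    rewrite (eq_bigr (fun=> 1)); last by move=> i _; case: (x1 (s i n)).
    by rewrite sumr_const card_ord.
  rewrite ger0_norm ?subr_ge0// lerBlDr -lerBlDl hN// => i.
  exact: leq_trans Nn (sn i n).
rewrite precompactE => cx.
(* Compactness is applied to the image of the filter at infinity, so that terms close to [z] occur
   at arbitrarily large indices. *)
have [|z [_ zx]] := cx (x n @[n --> \oo]) _ _.
  by exists 0%N => // n _; apply: subset_closure; exists n.
exists z => e e0 N.
have [|_ [[n /= Nn <-] xz]] := zx [set x n | n in [set n | (N <= n)%N]] _ _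
  (nbhsx_ballx z e e0).
  by exists N => // n Nn; exists n.
by exists n => //; move: xz; rewrite -ball_normE/= distrC.
Qed.

(** Normalizing reduces to the unit sphere: [a] times the normalized vector is at distance |a - |x
    n| | from [x n], which tends to 0. *)
Lemma rotund_cluster (x : nat -> E) (a : R) : 0 < a ->
  (forall n, decreasing_cone D f (x n)) ->
  `|x n| @[n --> \oo] --> a ->
  (forall e, 0 < e -> exists N, forall n : 'I_k -> nat,
    (forall i, (N <= n i)%N) -> k%:R * a - e <= `|\sum_i x (n i)|) ->
  exists z, forall e, 0 < e -> forall N, exists2 n, (N <= n)%N & `|x n - z| < e.
Proof.
move=> a0 xcone xa xsum.
have xae e : 0 < e -> exists N, forall n, (N <= n)%N -> `|a - `|x n| | <= e.
  by move=> e0; move/cvgrPdist_le : xa => /(_ e e0)[N _ h]; exists N => n /h.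
have [N0 hN0] := xae (a / 2) (divr_gt0 a0 (ltr0Sn _ 1)).
have x_gt0 n : (N0 <= n)%N -> 0 < `|x n|.
  move=> /hN0; rewrite ler_distl => /andP[_]; rewrite -lerBlDr; apply: lt_le_trans.
  by rewrite subr_gt0 ltr_pdivrMr// ltr_pMr// ltr1n.
pose y n := `|x (N0 + n)%N|^-1 *: x (N0 + n)%N.
have xN n : 0 < `|x (N0 + n)%N| by apply: x_gt0; rewrite leq_addr.
have ynear n : `|x (N0 + n)%N - a *: y n| = `|a - `|x (N0 + n)%N| |.
  rewrite /y scalerA -{1}(scale1r (x _)) -scalerBl normrZ.
  rewrite -{2}(normr_id (x _)) -normrM mulrBl mul1r -mulrA mulVf ?gt_eqF//.
  by rewrite mulr1 distrC.
have [n|e e0|z hz] := @rotund_cluster_unit y.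
- split; last by apply: cone_scale => //; rewrite invr_gt0.
  by rewrite /y normrZ ger0_norm ?invr_ge0// mulVf ?gt_eqF.
- have [e' e'0 e'e] : exists2 e' : R, 0 < e' & e' + e' = a * e.
    by exists (a * e / 2); rewrite -?splitr// divr_gt0// mulr_gt0.
  have [N1 hN1] := xsum e' e'0.
  have [N2 hN2] := xae (e' / k.+1%:R) (divr_gt0 e'0 (ltr0Sn _ k)).
  exists (maxn N1 N2) => n hn.
  have h1 : k%:R * a - e' <= `|\sum_i x (N0 + n i)%N|.
    apply: hN1 => i; apply: leq_trans (leq_addl _ _).
    by apply: leq_trans (hn i); rewrite leq_maxl.
  have h2 : `|\sum_i (x (N0 + n i)%N - a *: y (n i))| <= e'.
    apply: le_trans (ler_norm_sum _ _ _) _.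
    apply: (@le_trans _ _ (\sum_(i < k) (e' / k.+1%:R))).
      apply: ler_sum => i _; rewrite ynear; apply: hN2.
      apply: leq_trans (leq_addl _ _).
      by apply: leq_trans (hn i); rewrite leq_maxr.
    rewrite sumr_const card_ord -[leLHS]mulr_natr -mulrA ler_piMr ?ltW//.
    by rewrite ltr_pdivrMl// mulr1 ltr_nat.
  have h3 : k%:R * a - e' <= e' + a * `|\sum_i y (n i)|.
    apply: (le_trans h1).
    rewrite -[a in a * _](ger0_norm (ltW a0)) -normrZ.
    apply: le_trans (lerD h2 (lexx _)).
    apply: le_trans (ler_normD _ _).
    by rewrite sumrB -scaler_sumr subrK.
  rewrite -(ler_pM2l a0) mulrBr mulrC.
  by rewrite lerBlDl; move: h3; rewrite lerBlDl addrA e'e.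
- exists (a *: z) => e e0 N.
  have [N1 hN1] := xae (e / 2) (divr_gt0 e0 (ltr0Sn _ 1)).
  have [n Nn hn] := hz (e / 2 / a) (divr_gt0 (divr_gt0 e0 (ltr0Sn _ 1)) a0)
    (maxn N N1).
  exists (N0 + n)%N.
    by apply: leq_trans (leq_addl _ _); apply: leq_trans Nn; rewrite leq_maxl.
  rewrite -(subrK (a *: y n) (x _)) -addrA -scalerBr.
  apply: le_lt_trans (ler_normD _ _) _; rewrite [e]splitr; apply: ler_ltD.
    rewrite ynear; apply: hN1; apply: leq_trans (leq_addl _ _).
    by apply: leq_trans Nn; rewrite leq_maxr.
  by rewrite normrZ (ger0_norm (ltW a0)) mulrC -ltr_pdivlMr.
Qed.

End Rotundity.

End SymmetricSpaces.

(** * Heads and tails of elements of the cone *)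

Section Heads.
Context {R : realType} (D : set R).
Hypothesis HD : D = `[0, 1[%classic \/ D = `[0, +oo[%classic.
Local Notation mu := (@lebesgue_measure R).
Context (E : completeNormedModType R) (f : E -> R -> \bar R).
Hypothesis symE : symmetric_space D f.
Variable k : nat.
Hypothesis rotE : compactly_fully_rotund k (decreasing_cone D f).
Implicit Types (x y z : E).
Local Notation head T x := (restr D f (initial_segment T) x).

Lemma initial_segment_subset (S T : \bar R) : (S <= T)%E ->
  initial_segment S `<=` initial_segment T.
Proof. by move=> ST t [t0 tS]; split=> //; exact: lt_le_trans tS ST. Qed.

Lemma head_cluster x (T : nat -> \bar R) (a : R) : decreasing_cone D f x ->
  (forall n, 0 <= T n)%E ->
  nondecreasing_seq T \/ nonincreasing_seq T ->
  0 < a -> `|head (T n) x| @[n --> \oo] --> a ->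
  exists z, forall e, 0 < e -> forall N, exists2 n, (N <= n)%N &
    `|head (T n) x - z| < e.
Proof.
move=> xcone T0 monoT a0 ha.
apply: (rotund_cluster HD symE rotE a0 _ ha) => [n|e e0].
  exact: cone_restr.
have e'0 : 0 < e / k.+1%:R by rewrite divr_gt0.
move/cvgrPdist_le : ha => /(_ _ e'0)[N _ hN]; exists N => n Nn.
(* An index whose head is contained in all the chosen ones: [N] if [T] increases, one not below any
   n i if [T] decreases. *)
have [m Nm Tm] : exists2 m, (N <= m)%N & forall i, (T m <= T (n i))%E.
  case: monoT => mT; first by exists N => // i; exact: mT.
  exists (N + \sum_i n i)%N; first exact: leq_addr.
  move=> i; apply: mT; apply: leq_trans (leq_addl _ _).
  by rewrite (bigD1 i)//= leq_addr.
apply: (@le_trans _ _ `|\sum_(i < k) head (T m) x|).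
  have := hN m Nm; rewrite /= ler_distl => /andP[_ h].
  have -> : \sum_(i < k) head (T m) x = k%:R *: head (T m) x.
    by rewrite sumr_const card_ord scaler_nat.
  rewrite normrZ normr_nat.
  rewrite lerBlDr; apply: (@le_trans _ _ (k%:R * (`|head (T m) x| + e / k.+1%:R))).
    by rewrite ler_wpM2l.
  rewrite mulrDr lerD2l mulrCA ler_piMr ?ltW//.
  by rewrite ltr_pdivrMr// mul1r ltr_nat.
apply: (norm_sum_le symE) => i; apply: (restr_subset HD symE) => //.
- exact: measurable_initial_segment.
- exact: measurable_initial_segment.
- by apply: initial_segment_subset; exact: Tm.
- exact: cone_ge0.
Qed.

(** The origin lies in every head of positive length, and limits of rearrangements are controlled
    only at t > 0. *)
Lemma ae_neq0 : {ae mu, forall t : R, D t -> t != 0}.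
Proof.
exists [set 0]; split=> //; first exact: lebesgue_measure_set1.
move=> t /= h; apply: contrapT => t0; apply: h => _.
exact/eqP.
Qed.

Lemma head_small x e : decreasing_cone D f x -> 0 < e ->
  exists n, `|head (n.+1%:R^-1)%:E x| < e.
Proof.
move=> xcone e0; apply: contrapT => /forallNP he.
pose T n : \bar R := (n.+1%:R^-1)%:E.
have T0 n : (0 <= T n)%E by rewrite lee_fin invr_ge0.
have niT : nonincreasing_seq T.
  by move=> m n mn; rewrite lee_fin lef_pV2 ?posrE// ler_nat.
have mS n := measurable_initial_segment (T n).
pose u n := `|head (T n) x|.
have ui : nonincreasing_seq u.
  move=> m n mn; apply: (norm_le symE).
  have := restr_subset HD symE (mS n) (mS m)
    (initial_segment_subset (niT _ _ mn)) (cone_ge0 xcone).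
  by apply: ae_on_imp => t _ /andP[h1 h2]; rewrite !gee0_abs//; exact: le_trans h2.
have ue n : e <= u n by rewrite leNgt; apply/negP; exact: he.
have ulb : has_lbound (range u) by exists e => _ [n _ <-]; exact: ue.
have ua := nonincreasing_cvgn ui ulb.
have ea : e <= inf (range u).
  by apply: lb_le_inf; [exists (u 0%N), 0%N|move=> _ [n _ <-]].
have [z hz] := head_cluster xcone T0 (or_intror niT) (lt_le_trans e0 ea) ua.
have z0 : z = 0.
  apply: (restr_bigcup0 HD symE (A := fun n => ~` initial_segment (T n))).
  - by move=> n; exact: measurableC.
  - apply: ae_on_imp ae_neq0 => t Dt t0.
    have t_gt0 : 0 < t by rewrite lt_neqAle eq_sym t0/=; exact: interval_ge0 Dt.
    have /ltr_add_invr[n] := t_gt0; rewrite add0r => nt.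
    by exists n => -[_]; rewrite lte_fin ltNge ltW.
  move=> m; apply/normr0_eq0/eqP; rewrite eq_le normr_ge0 andbT.
  apply/ler_addgt0Pr => e' e'0; rewrite add0r.
  (* Past index [m] the heads vanish off the [m]-th segment, so off it the norm of [z] is at most
     its distance to such a head. *)
  have [n mn hn] := hz _ e'0 m.
  have mC : measurable (~` initial_segment (T m)) by exact: measurableC.
  have : restr D f (~` initial_segment (T m)) (head (T n) x - z) =
      - restr D f (~` initial_segment (T m)) z.
    rewrite restrB// restrI// (_ : _ `&` _ = set0) ?restr_set0 ?sub0r//.
    rewrite -subset0 => t [h1 h2]; apply: h1.
    by apply: initial_segment_subset h2; exact: niT.
  move/(congr1 Num.norm); rewrite normrN => <-.
  exact: le_trans (norm_restr_le HD symE _ mC) (ltW hn).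
have [n _] := hz e e0 0%N.
by rewrite z0 subr0 ltNge ue.
Qed.

Hypothesis fatouE : fatou_property D f.

(** At almost every point the heads increase and are eventually equal to [f x], so the Fatou
    property applies. *)
Lemma head_cvg x : {ae mu, forall t, D t -> (0 <= f x t)%E} ->
  `|head n%:R%:E x| @[n --> \oo] --> `|x|.
Proof.
move=> x0; have mS n := measurable_initial_segment (n%:R%:E : \bar R).
have hE : {ae mu, forall t, D t -> forall n : nat,
    f (head n%:R%:E x) t = (f x \_ (initial_segment n%:R%:E)) t}.
  have : {ae mu, forall t, forall n : nat, D t ->
      f (head n%:R%:E x) t = (f x \_ (initial_segment n%:R%:E)) t}.
    by apply: ae_foralln => n; exact: restrE.
  by apply: (@filterS _ (almost_everywhere mu)) => t h Dt n; exact: h.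
have [||||z [zx _]] := fatouE (x_ := fun n => head n%:R%:E x) (x := f x).
- exact: rep_measurable.
- move=> n; apply: ae_on_imp2 hE x0 => t _ -> fx0.
  by rewrite patchE; case: ifP.
- by exists `|x| => _ [n _ <-]; exact: norm_restr_le.
- apply: ae_on_imp2 hE x0 => t Dt h fx0; split.
    move=> m n mn; rewrite !h !patchE.
    case: ifPn => [/set_mem|]; last by case: ifP.
    move=> tm; rewrite mem_set ?lexx//.
    by apply: initial_segment_subset tm; rewrite lee_fin ler_nat.
  apply: cvg_near_cst; exists (Num.truncn t).+1 => // n /= tn.
  rewrite h patchE mem_set//; split; first exact: interval_ge0 Dt.
  rewrite lte_fin; apply: lt_le_trans (truncnS_gt t) _.
  by rewrite ler_nat.
- by rewrite (rep_inj symE (x := z) (y := x)).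
Qed.

Lemma tail_small x e : decreasing_cone D f x -> 0 < e ->
  exists n : nat, `|x - head n%:R%:E x| < e.
Proof.
move=> xcone e0; have x0 := cone_ge0 xcone.
(* The zero vector is set apart because [head_cluster] needs a positive limit of the norms. *)
have [xe|xe] := eqVneq x 0.
  exists 0%N; rewrite xe sub0r normrN.
  apply: le_lt_trans e0; rewrite -(@normr0 _ E).
  by apply: norm_restr_le => //; exact: measurable_initial_segment.
have x_gt0 : 0 < `|x| by rewrite normr_gt0.
pose T n : \bar R := n%:R%:E.
have T0 n : (0 <= T n)%E by rewrite lee_fin.
have ndT : nondecreasing_seq T by move=> m n mn; rewrite lee_fin ler_nat.
have mS n := measurable_initial_segment (T n).
have [z hz] := head_cluster xcone T0 (or_introl ndT) x_gt0 (head_cvg x0).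
suff /eqP : x - z = 0.
  rewrite subr_eq0 => /eqP xz; have [n _] := hz e e0 0%N.
  by rewrite -xz distrC; exists n.
apply: (restr_bigcup0 HD symE (A := fun n => initial_segment (T n))) => //.
  apply: ae_onW => t Dt; exists (Num.truncn t).+1; split; first exact: interval_ge0 Dt.
  by rewrite lte_fin truncnS_gt.
move=> m; apply/normr0_eq0/eqP; rewrite eq_le normr_ge0 andbT.
apply/ler_addgt0Pr => e' e'0; rewrite add0r.
have [n mn hn] := hz _ e'0 m.
(* For n >= m the [n]-th head of [x] and [x] itself have the same restriction to the [m]-th segment,
   so x - z is small there. *)
have -> : head (T m) (x - z) = head (T m) (head (T n) x - z).
  rewrite !restrB// restrI//; congr (restr _ _ _ _ - _).
  by rewrite setIidl//; apply: initial_segment_subset; exact: ndT.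
exact: le_trans (norm_restr_le HD symE _ (mS m)) (ltW hn).
Qed.

End Heads.

(** * Indicators of bounded segments *)

Section Indicators.
Context {R : realType} (D : set R).
Hypothesis HD : D = `[0, 1[%classic \/ D = `[0, +oo[%classic.
Local Notation mu := (@lebesgue_measure R).
Local Notation d := (distribution_function D).
Context (E : completeNormedModType R) (f : E -> R -> \bar R).
Hypothesis symE : symmetric_space D f.
Let mD := measurable_interval HD.
Let bfsE := sym_bfs symE.
Implicit Types (x y z : E) (A : set R).
Local Notation chi A := (EFin \o \1_A).

Lemma measurable_chi A : measurable A -> L0 D (chi A).
Proof. by move=> mA; apply/measurable_EFinP; exact: measurable_indic. Qed.

Lemma distribution_chi A l : 0 <= l ->
  d (chi A) l = if l < 1 then mu (D `&` A) else 0%E.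
Proof.
move=> l0; rewrite /distribution_function; case: ifPn => l1.
  congr (mu _); apply/seteqP; split=> t [Dt /=].
    rewrite indicE; have [/set_mem|_] := boolP (t \in A) => //.
    by rewrite normr0 lte_fin ltNge l0.
  by move=> At; split=> //=; rewrite indicE mem_set// normr1 lte_fin.
rewrite (_ : _ `&` _ = set0) ?measure0// -subset0 => t [_ /=].
rewrite indicE ger0_norm// lte_fin; case: (_ \in _) => /=.
  by rewrite (negbTE l1).
by rewrite ltNge l0.
Qed.

Lemma ge1_measure_interval : (1 <= mu D)%E.
Proof.
by case: HD => ->; rewrite lebesgue_measure_itv/= ?lte_fin ?ltr01 ?ltry oppr0 adde0//= leey.
Qed.

(** A weak unit [w] is positive almost everywhere, so it exceeds some l > 0 on a set of measure more
    than 1/2, a length below [mu D] for both choices of [D]; w/l then dominates the indicator in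
    distribution. *)
Let chi_half : exists x, belongs D f (chi (initial_segment (2^-1)%:E)) x.
Proof.
have [w w0] := bfs_weak_unit bfsE.
have mw := rep_measurable symE w.
have dw0 : (mu D <= d (f w) 0)%E.
  have [N [mN N0 wN]] := w0.
  have mw0 := measurable_superlevel HD 0 mw.
  apply: (@le_trans _ _ (mu ((D `&` [set s | (0%:E < `|f w s|)%E]) `|` N))).
    apply: le_lebesgue_measure => //; first exact: measurableU.
    move=> t Dt; have [Nt|Nt] := pselect (N t); [by right|left].
    split=> //=; have : D t -> (0 < f w t)%E by apply: contrapT => h; exact: Nt (wN _ h).
    by move=> /(_ Dt) wt; rewrite gee0_abs// ltW.
  apply: le_trans (measureU2 mu mw0 mN) _.
  by rewrite [X in (_ + X)%E](N0 : mu N = 0%E) adde0.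
have [l l0 dl] : exists2 l, 0 < l & ((2^-1)%:E < d (f w) l)%E.
  apply: contrapT => h; have : (d (f w) 0 <= (2^-1)%:E)%E.
    apply: distribution_right_continuous => // l l0; rewrite leNgt; apply/negP => dl.
    by apply: h; exists l.
  apply/negP; rewrite -ltNge; apply: lt_le_trans (le_trans ge1_measure_interval dw0).
  by rewrite lte_fin invf_lt1// ltr1n.
have mS : measurable (initial_segment ((2^-1)%:E : \bar R)).
  exact: measurable_initial_segment.
have [|z zE _] := rep_distribution_le HD symE (y := l^-1 *: w)
    (measurable_chi mS); last by exists z.
move=> l' l'0.
have -> : d (f (l^-1 *: w)) l' = d (f w) (l * l').
  have := @ae_eq_distribution _ _ HD _ _ (rep_measurable symE (l^-1 *: w)) _
    (bfs_scale bfsE l^-1 w).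
  move=> ->; last exact: measurable_funeM.
  by rewrite distribution_scale ?invr_gt0// invrK.
rewrite distribution_chi//; case: ifPn => // l'1.
have SD : ((2^-1)%:E <= mu D)%E.
  by apply: le_trans ge1_measure_interval; rewrite lee_fin invf_le1// ler1n.
rewrite (interval_initial_segment_le HD SD).
rewrite lebesgue_measure_initial_segment ?lee_fin ?invr_ge0//.
apply: le_trans (ltW dl) _; apply: distribution_nonincreasing => //.
by rewrite ler_piMr// ltW.
Qed.

(** Blocks of length 1/2 are added one at a time: each is dominated in distribution by the indicator
    of [0, 1/2), and finitely many cover the segment. *)
Lemma rep_chi_initial_segment (T : R) :
  exists x, belongs D f (chi (initial_segment T%:E)) x.
Proof.
have [e0 e0E] := chi_half.
pose S (n : nat) : set R := initial_segment (n%:R / 2)%:E.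
have mS (T : \bar R) := measurable_initial_segment T.
have main n : exists x, belongs D f (chi (S n)) x.
  elim: n => [|n [x xE]].
    exists 0; apply: ae_on_imp (rep0 symE) => t Dt -> /=.
    rewrite indicE memNset// => -[t0]; rewrite mul0r lte_fin.
    by rewrite ltNge t0.
  have [|y yE _] := rep_distribution_le HD symE (y := e0)
      (measurable_chi (measurableD (mS _) (mS _) : measurable (S n.+1 `\` S n))).
    move=> l l0.
    rewrite (@ae_eq_distribution _ _ HD _ _ (rep_measurable symE e0) (measurable_chi (mS _)) e0E).
    rewrite !distribution_chi//; case: ifPn => // _.
    have -> : S n.+1 `\` S n = `[(n%:R / 2), (n.+1%:R / 2)[%classic.
      apply/seteqP; split=> t; rewrite /S /initial_segment /= in_itv/=.
        move=> [[t0]]; rewrite !lte_fin => tn h; rewrite tn andbT leNgt.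
        by apply/negP => h'; apply: h.
      move=> /andP[nt tn]; have t0 : 0 <= t by apply: le_trans nt; rewrite divr_ge0.
      by rewrite !lte_fin; split=> // -[_]; rewrite ltNge nt.
    have SD : ((2^-1)%:E <= mu D)%E.
      by apply: le_trans ge1_measure_interval; rewrite lee_fin invf_le1// ler1n.
    rewrite (interval_initial_segment_le HD SD).
    rewrite lebesgue_measure_initial_segment ?lee_fin ?invr_ge0//.
    apply: (@le_trans _ _ (mu `[(n%:R / 2), (n.+1%:R / 2)[%classic)).
      by apply: le_lebesgue_measure => //; exact: measurableI.
    rewrite lebesgue_measure_itv/= lte_fin ltr_pM2r ?invr_gt0// ltr_nat leqnn.
    by rewrite -EFinB -mulrBl -natrB// subSnn mul1r.
  exists (x + y); apply: ae_on_imp3 (bfs_add bfsE x y) xE yE => t _ -> -> ->.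
  rewrite /= !indicE in_setD -EFinD.
  have [tS|tS] := boolP (t \in S n).
    rewrite mem_set ?addr0//; move/set_mem : tS; apply: initial_segment_subset.
    by rewrite lee_fin ler_pM2r ?invr_gt0// ler_nat.
  by rewrite add0r; case: (t \in S n.+1).
pose n := (Num.truncn (T * 2)).+1.
have [x xE] := main n.
have [|z zE _] := bfs_ideal bfsE (y := x) (measurable_chi (mS T%:E)); last by exists z.
apply: ae_on_imp xE => t Dt ->; rewrite /= lee_fin !ger0_norm// !indicE.
have [/set_mem tT|//] := boolP (t \in initial_segment T%:E).
rewrite mem_set ?ler1//; apply: initial_segment_subset tT.
by rewrite lee_fin ler_pdivlMr// ltW// truncnS_gt.
Qed.

End Indicators.

Section DistributionConvergence.
Context {R : realType} (D : set R).
Hypothesis HD : D = `[0, 1[%classic \/ D = `[0, +oo[%classic.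
Local Notation mu := (@lebesgue_measure R).
Local Notation d := (distribution_function D).
Let mD := measurable_interval HD.

(** Dominated convergence for the indicators of the superlevel sets at [l]; the majorant is that of
    [g], whose integral is finite. *)
Lemma distribution_cvg0 (g : R -> \bar R) (g_ : nat -> R -> \bar R) (l : R) :
  0 < l -> L0 D g -> (forall n, L0 D (g_ n)) -> (d g l < +oo)%E ->
  (forall n, {ae mu, forall t, D t -> (`|g_ n t| <= `|g t|)%E}) ->
  {ae mu, forall t, D t -> g_ n t @[n --> \oo] --> 0%E} ->
  d (g_ n) l @[n --> \oo] --> 0%E.
Proof.
move=> l0 mg mg_ dg g_g g_0.
pose A (h : R -> \bar R) := D `&` [set s | (l%:E < `|h s|)%E].
have mA h : L0 D h -> measurable (A h) by exact: measurable_superlevel.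
have intA h : L0 D h -> (\int[mu]_(t in D) (\1_(A h) t)%:E = d h l)%E.
  move=> mh; rewrite integral_indic//; last exact: mA.
  by rewrite /A setIC setIA setIid.
have mchi h : L0 D h -> measurable_fun D (fun t : R => (\1_(A h) t)%:E).
  by move=> mh; apply/measurable_EFinP; apply: measurable_indic; exact: mA.
have [|||||_ _] := @dominated_convergence _ _ _ mu D mD
    (fun n t => (\1_(A (g_ n)) t)%:E) (cst 0%E) (fun t => (\1_(A g) t)%:E).
- by move=> n; exact: mchi.
- exact: measurable_cst.
- apply: ae_on_imp g_0 => t Dt gt.
  have gt' : `|g_ n t|%E @[n --> \oo] --> 0%E by rewrite -(@abse0 R); exact: cvg_abse.
  have [N hN] := cvge_lt_eventually gt' (l0 : (0 < l%:E)%E).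
  apply: cvg_near_cst; exists N => // n /= Nn.
  rewrite indicE memNset//= => -[_ /=]; apply/negP; rewrite -leNgt ltW//.
  exact: hN.
- apply/integrableP; split; first exact: mchi.
  under eq_integral do rewrite gee0_abs ?lee_fin//.
  by rewrite intA.
- have : {ae mu, forall t, forall n, D t -> (`|g_ n t| <= `|g t|)%E}.
    exact: ae_foralln.
  apply: (@filterS _ (almost_everywhere mu)) => t h n Dt.
  rewrite gee0_abs ?lee_fin// !indicE.
  have [/set_mem[_ /= lg]|//] := boolP (t \in A (g_ n)).
  by rewrite mem_set//; split=> //=; exact: lt_le_trans (h n Dt).
rewrite integral_cst// mul0e; apply: cvg_trans.
by under eq_cvg do rewrite -intA//.
Qed.

End DistributionConvergence.

(** * Order continuity of the space *)

Section OrderContinuity.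
Context {R : realType} (D : set R).
Hypothesis HD : D = `[0, 1[%classic \/ D = `[0, +oo[%classic.
Local Notation mu := (@lebesgue_measure R).
Local Notation d := (distribution_function D).
Local Notation rearr := (rearrangement D).
Context (E : completeNormedModType R) (f : E -> R -> \bar R).
Hypothesis symE : symmetric_space D f.
Variable k : nat.
Hypothesis rotE : compactly_fully_rotund k (decreasing_cone D f).
Hypothesis fatouE : fatou_property D f.
Let mD := measurable_interval HD.
Let bfsE := sym_bfs symE.
Implicit Types (x y z : E).

Lemma distribution_infinite g l : L0 D g -> 0 < l -> d g l = +oo%E ->
  D = `[0, +oo[%classic.
Proof.
move=> mg l0 dg; case: HD => // D1.
have := distribution_le HD l mg; rewrite dg D1 lebesgue_measure_itv/=.
by rewrite lte_fin ltr01 oppr0 adde0.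
Qed.

(** Otherwise the rearrangement of [x] exceeds [l] on the whole half line, so the constant [l]
    belongs to the space. Each tail of the rearrangement dominates it in distribution, and far tails
    have small norm, so this constant would be 0. *)
Lemma finite_distribution x l : 0 < l -> (d (f x) l < +oo)%E.
Proof.
move=> l0; rewrite ltey; apply/eqP => dx.
have mx := rep_measurable symE x.
have Doo := distribution_infinite mx l0 dx.
have [y [yE _ ycone]] := rep_star HD symE x.
have y_gt t : D t -> (l%:E < rearr (f x) t)%E.
  by move=> _; rewrite rearrangement_gt ?ltW// dx ltry.
have mcst : L0 D (cst l%:E) by exact: measurable_cst.
have [c cE _] : exists2 z, belongs D f (cst l%:E) z & `|z| <= `|y|.
  apply: (bfs_ideal bfsE) => //; apply: ae_on_imp yE => t Dt ->.
  by rewrite !gee0_abs ?rearrangement_ge0 ?lee_fin ?(ltW l0)// ltW// y_gt.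
have dc l' : d (f c) l' = d (cst l%:E) l'.
  by apply: ae_eq_distribution => //; exact: rep_measurable.
suff c0 : c = 0.
  have := dc 0; rewrite c0 (@ae_eq_distribution _ _ HD _ (cst 0%E))//; last 3 first.
  - exact: rep_measurable.
  - exact: measurable_cst.
  - exact: rep0.
  rewrite /distribution_function (_ : _ `&` _ = set0); last first.
    by rewrite -subset0 => t [_ /=]; rewrite normr0 ltxx.
  rewrite measure0 (_ : D `&` _ = D); last first.
    apply/seteqP; split=> [t []//|t Dt]; split=> //=.
    by rewrite lte_fin normr_gt0 gt_eqF.
  by rewrite Doo lebesgue_measure_itv/= ltry oppr0 adde0.
apply/normr0_eq0/eqP; rewrite eq_le normr_ge0 andbT.
apply/ler_addgt0Pr => e e0; rewrite add0r.
have [n hn] := tail_small HD symE rotE fatouE ycone e0.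
apply: le_trans (ltW hn); apply: (norm_distribution_le HD symE) => l' l'0.
have mS := measurable_initial_segment (n%:R%:E : \bar R).
rewrite dc; have [l'l|ll'] := ltP l' l; last first.
  rewrite [leLHS](_ : _ = 0%E) ?distribution_ge0//.
  rewrite /distribution_function (_ : _ `&` _ = set0) ?measure0//.
  by rewrite -subset0 => t [_ /=]; rewrite lte_fin gtr0_norm// ltNge ll'.
apply: (@le_trans _ _ +oo%E); first exact: leey.
have mt : L0 D (f (y - restr D f (initial_segment n%:R%:E) y)).
  exact: rep_measurable.
have tE : ae_eq mu D (f (y - restr D f (initial_segment n%:R%:E) y))
    (rearr (f x) \_ (~` initial_segment n%:R%:E)).
  rewrite restrC//; apply: ae_on_imp2 (restrE HD symE y (measurableC mS)) yE => t _ ->.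
  by rewrite !patchE => ->.
have mh : L0 D (rearr (f x) \_ (~` initial_segment n%:R%:E)).
  apply/(measurable_restrict _ (measurableC mS) mD).
  by apply: measurable_funS (measurable_rearrangement HD mx) => //; exact: subIsetl.
rewrite (ae_eq_distribution HD mt mh tE).
apply: (@le_trans _ _ (mu `[n%:R, +oo[%classic)).
  by rewrite lebesgue_measure_itv/= ltry.
apply: le_lebesgue_measure => //; first exact: measurable_superlevel.
move=> t /=; rewrite in_itv/= andbT => nt.
have Dt : D t by rewrite Doo/= in_itv/= andbT; exact: le_trans nt.
split=> //=; rewrite patchE mem_set.
  rewrite gee0_abs ?rearrangement_ge0//.
  by apply: lt_trans (y_gt t Dt); rewrite lte_fin.
by case=> _; rewrite lte_fin ltNge nt.
Qed.

Lemma symmetric_order_continuous :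
  order_continuous D [set: E] f (fun x => `|x|%:E).
Proof.
move=> x x_ _ _ x_ge0 x_le x_0.
have mx := rep_measurable symE x.
have mx_ n := rep_measurable symE (x_ n).
have [y [yE _ ycone]] := rep_star HD symE x.
suff : `|x_ n| @[n --> \oo] --> (0 : R).
  by move=> h; apply: (cvg_comp _ _ h); exact: cvg_id.
apply/cvgrPdist_le => e e0.
have e3 : 0 < e / 3%:R by rewrite divr_gt0.
(* Three errors of e/3: a short head, a far tail, and a small multiple [eta] of the indicator of [0,
   p). *)
have [m hm] := head_small HD symE rotE ycone e3.
have [p hp] := tail_small HD symE rotE fatouE ycone e3.
have [c cE] := rep_chi_initial_segment HD symE p%:R.
have [eta eta0 ceta] : exists2 eta : R, 0 < eta & `|eta *: c| <= e / 3%:R.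
  exists (e / 3%:R / (1 + `|c|)); first by rewrite divr_gt0// ltr_wpDr.
  rewrite normrZ gtr0_norm; last by rewrite divr_gt0// ltr_wpDr.
  by rewrite mulrAC ler_pdivrMr ?ltr_wpDr// ler_pM2l// lerDr.
have x_le' n : {ae mu, forall t, D t -> (`|f (x_ n) t| <= `|f x t|)%E}.
  by apply: ae_on_imp2 (x_ge0 n) (x_le n) => t _ h1 h2; rewrite (gee0_abs h1).
have m_gt0 : (0 < (m.+1%:R^-1 : R)%:E)%E by rewrite lte_fin invr_gt0.
(* From [N] on, |x_n| exceeds [eta] on a set of measure below 1/(m+1), so its rearrangement is at
   most [eta] beyond 1/(m+1). *)
have [N hN] := cvge_lt_eventually (distribution_cvg0 HD eta0 mx mx_
  (finite_distribution x eta0) x_le' x_0) m_gt0.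
exists N => // n /= Nn; rewrite sub0r normrN normr_id.
have [z [zE <- _]] := rep_star HD symE (x_ n).
set h := restr D f (initial_segment (m.+1%:R^-1)%:E) y in hm.
set w := y - _ in hp.
have mS1 := measurable_initial_segment ((m.+1%:R^-1)%:E : \bar R).
have mS2 := measurable_initial_segment (p%:R%:E : \bar R).
apply: (@le_trans _ _ `|h + w + eta *: c|); last first.
  apply: le_trans (ler_normD _ _) _.
  have -> : e = e / 3%:R + e / 3%:R + e / 3%:R.
    by lra.
  apply: lerD => //; apply: le_trans (ler_normD _ _) _.
  by apply: lerD; exact: ltW.
apply: (norm_le symE).
have hE : ae_eq mu D (f h) (rearr (f x) \_ (initial_segment (m.+1%:R^-1)%:E)).
  by apply: ae_on_imp2 (restrE HD symE y mS1) yE => t _ ->; rewrite !patchE => ->.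
have wE : ae_eq mu D (f w) (rearr (f x) \_ (~` initial_segment p%:R%:E)).
  rewrite /w restrC//; apply: ae_on_imp2 (restrE HD symE y (measurableC mS2)) yE => t _ ->.
  by rewrite !patchE => ->.
have hwcE : ae_eq mu D (f (h + w + eta *: c)) (fun t => (
   (rearr (f x) \_ (initial_segment (m.+1%:R^-1)%:E)) t +
   (rearr (f x) \_ (~` initial_segment p%:R%:E)) t +
   eta%:E * (\1_(initial_segment p%:R%:E) t)%:E)%E).
  have h1 : ae_eq mu D (f (h + w)) (fun t => (
     (rearr (f x) \_ (initial_segment (m.+1%:R^-1)%:E)) t +
     (rearr (f x) \_ (~` initial_segment p%:R%:E)) t)%E).
    by apply: ae_on_imp3 (bfs_add bfsE h w) hE wE => t _ -> -> ->.
  have h2 : ae_eq mu D (f (eta *: c))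
     (fun t => eta%:E * (\1_(initial_segment p%:R%:E) t)%:E)%E.
    by apply: ae_on_imp2 (bfs_scale bfsE eta c) cE => t _ -> ->.
  by apply: ae_on_imp3 (bfs_add bfsE (h + w) (eta *: c)) h1 h2 => t _ -> -> ->.
apply: ae_on_imp2 zE hwcE => t Dt -> ->.
have r0 := rearrangement_ge0 D (f x) t.
have rn0 := rearrangement_ge0 D (f (x_ n)) t.
have rle : (rearr (f (x_ n)) t <= rearr (f x) t)%E.
  by apply: le_rearrangement => // l l0; exact: ae_le_distribution.
have t0 := interval_ge0 HD Dt.
have c0 : (0 <= eta%:E * (\1_(initial_segment p%:R%:E) t)%:E)%E.
  by rewrite -EFinM lee_fin mulr_ge0// ltW.
have p0 A : (0 <= (rearr (f x) \_ A) t)%E by rewrite patchE; case: ifP.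
rewrite !gee0_abs ?adde_ge0//.
(* Far tail, short head, and the middle range, where only the level [eta] is used. *)
have [tp|pt] := boolP (t%:E < p%:R%:E)%E; last first.
  apply: le_trans rle _; rewrite -[leLHS]adde0 leeD//.
  rewrite -[leLHS]add0e leeD//.
  rewrite [leRHS]patchE mem_set//.
  by case=> _; apply/negP.
have [tm|mt] := boolP (t%:E < (m.+1%:R^-1)%:E)%E.
  apply: le_trans rle _; rewrite -[leLHS]adde0 leeD//.
  rewrite -[leLHS]adde0 leeD//.
  have tS : initial_segment (m.+1%:R^-1)%:E t by split.
  by rewrite [leRHS]patchE (mem_set tS).
apply: (@le_trans _ _ eta%:E).
  rewrite rearrangement_le//; last exact: ltW.
  by apply: le_trans (ltW (hN n Nn)) _; rewrite leNgt.
rewrite -[leLHS]add0e leeD ?adde_ge0//.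
have tS : initial_segment p%:R%:E t by split.
by rewrite indicE (mem_set tS) mule1.
Qed.

End OrderContinuity.

(** * The associate space *)

Section AssociateSpace.
Context {R : realType} (D : set R).
Hypothesis HD : D = `[0, 1[%classic \/ D = `[0, +oo[%classic.
Local Notation mu := (@lebesgue_measure R).
Context (E : completeNormedModType R) (f : E -> R -> \bar R).
Hypothesis symE : symmetric_space D f.
Hypothesis fatouE : fatou_property D f.
Let mD := measurable_interval HD.
Let bfsE := sym_bfs symE.
Implicit Types (x z : E) (y w : R -> \bar R).

Lemma rep_abs x : exists2 z, ae_eq mu D (f z) (fun t => `|f x t|%E) & `|z| = `|x|.
Proof.
have mx := rep_measurable symE x.
have [||z zE zx] := bfs_ideal bfsE (x := fun t => `|f x t|%E) (y := x).
- exact: measurableT_comp.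
- by apply: ae_onW => t _; rewrite abse_id.
exists z => //; apply/eqP; rewrite eq_le zx/=; apply: (norm_le symE).
by apply: ae_on_imp zE => t _ ->; rewrite abse_id.
Qed.

Lemma measurable_pairing x y : L0 D y -> measurable_fun D (fun t => `|f x t * y t|%E).
Proof.
move=> my; apply: measurableT_comp => //; apply: emeasurable_funM => //.
exact: rep_measurable.
Qed.

Lemma pairing_scale c x y : L0 D y -> 0 <= c ->
  (\int[mu]_(t in D) `|f (c *: x) t * y t| =
   c%:E * \int[mu]_(t in D) `|f x t * y t|)%E.
Proof.
move=> my c0; rewrite -ge0_integralZl//; last exact: measurable_pairing.
apply: ge0_ae_eq_integral => //; last first.
- apply: ae_on_imp (bfs_scale bfsE c x) => t _ ->.
  by rewrite -muleA abseM [`|c%:E|%E]gee0_abs.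
- by move=> t _; rewrite mule_ge0.
- by apply: measurable_funeM; exact: measurable_pairing.
- exact: measurable_pairing.
Qed.

Lemma pairing_le x z y w : L0 D y -> L0 D w ->
  {ae mu, forall t, D t -> (`|f x t * y t| <= `|f z t * w t|)%E} ->
  (\int[mu]_(t in D) `|f x t * y t| <= \int[mu]_(t in D) `|f z t * w t|)%E.
Proof.
by move=> my mw h; apply: ae_ge0_le_integral => //; exact: measurable_pairing.
Qed.

(** Uniform boundedness by summation: otherwise there are [z n] of norm at most 2^-(n+1) with
    pairing at least [n], and the sum of the |z n|, in the space by the Fatou property, has infinite
    pairing with [y]. *)
Lemma associate_bound y : associate_space D f y ->
  exists2 C, 0 < C & forall x, (\int[mu]_(t in D) `|f x t * y t| <= (C * `|x|)%:E)%E.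
Proof.
move=> [my yfin]; apply: contrapT => noC.
have big C : 0 < C -> exists x, ((C * `|x|)%:E < \int[mu]_(t in D) `|f x t * y t|)%E.
  move=> C0; apply: contrapT => /forallNP h; apply: noC; exists C => // x.
  by rewrite leNgt; apply/negP; exact: h.
have /choice[z zP] (n : nat) : exists z, `|z| <= 2^-1 ^+ n.+1 /\
    (n%:R%:E <= \int[mu]_(t in D) `|f z t * y t|)%E.
  (* The constant is chosen so that scaling [x] to norm 2^-(n+1) leaves a pairing of at least n +
     1. *)
  have [x hx] := big (n.+1%:R * 2 ^+ n.+1) (mulr_gt0 (ltr0Sn _ _) (exprn_gt0 _ (ltr0Sn _ _))).
  have x0 : 0 < `|x|.
    rewrite normr_gt0; apply/eqP => x0; move: hx; rewrite x0 normr0 mulr0.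
    by rewrite -(scale0r (0 : E)) pairing_scale// mul0e ltxx.
  have [c [c0 cx cn]] : exists c : R, [/\ 0 < c, c * `|x| = 2^-1 ^+ n.+1 &
      c * (n.+1%:R * 2 ^+ n.+1 * `|x|) = n.+1%:R].
    exists (2^-1 ^+ n.+1 / `|x|); rewrite divr_gt0// ?exprn_gt0 ?invr_gt0//.
    have e0 : (2 ^+ n.+1 : R) != 0 by rewrite expf_neq0.
    have x0' : `|x| != 0 by rewrite gt_eqF.
    split=> //; first by rewrite divfK.
    have cancel (u v m : R) : u != 0 -> v != 0 -> u^-1 / v * (m * u * v) = m.
      by move=> u0 v0; field; rewrite v0 u0.
    by rewrite exprVn cancel.
  exists (c *: x); split; first by rewrite normrZ gtr0_norm// cx.
  rewrite pairing_scale ?(ltW c0)//.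
  apply: (@le_trans _ _ (c%:E * (n.+1%:R * 2 ^+ n.+1 * `|x|)%:E)%E).
    by rewrite -EFinM cn lee_fin ler_nat.
  by apply: lee_wpmul2l; [rewrite lee_fin ltW|exact: ltW].
have /choice[a aP] (n : nat) : exists a,
    ae_eq mu D (f a) (fun t => `|f (z n) t|%E) /\ `|a| = `|z n|.
  by have [a ? ?] := rep_abs (z n); exists a.
pose s N := \sum_(i < N) a i.
pose G N t := (\sum_(i < N) `|f (z i) t|)%E.
pose g t := ereal_sup (range (G ^~ t)).
have ndG t : nondecreasing_seq (G ^~ t).
  apply/nondecreasing_seqP => n; rewrite /G big_ord_recr/=.
  by rewrite leeDl.
have Gg t : G n t @[n --> \oo] --> g t by exact: ereal_nondecreasing_cvgn.
have mG N : measurable_fun D (G N).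
  apply: emeasurable_sum => i; apply: measurableT_comp => //.
  exact: rep_measurable.
have mg : L0 D g by exact: emeasurable_fun_cvg mG (fun t _ => Gg t).
have sE : {ae mu, forall t, D t -> forall N, f (s N) t = G N t}.
  have aE : {ae mu, forall t, forall n, D t -> f (a n) t = `|f (z n) t|%E}.
    by apply: ae_foralln => n; have [] := aP n.
  have s_sum : {ae mu, forall t, forall N, D t -> f (s N) t = (\sum_(i < N) f (a i) t)%E}.
    by apply: ae_foralln => N; exact: (rep_sum symE (index_enum 'I_N) predT (fun i => a i)).
  apply: (@filterS2 _ (almost_everywhere mu)) aE s_sum => t h1 h2 Dt N.
  by rewrite h2//; apply: eq_bigr => i _; exact: h1.
have s_le N : `|s N| <= 1 - 2^-1 ^+ N.
  elim: N => [|N IH]; first by rewrite /s big_ord0 normr0 expr0 subrr.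
  rewrite /s big_ord_recr/=; apply: le_trans (ler_normD _ _) _.
  have [_ aN] := aP N; have [zN _] := zP N.
  have := lerD IH (_ : `|a N| <= 2^-1 ^+ N.+1); rewrite aN => /(_ zN) /le_trans; apply.
  by rewrite exprS; lra.
have [|||v [vE _ _]] := fatouE (x_ := s) (x := g) mg.
- by move=> N; apply: ae_on_imp sE => t _ ->; exact: sume_ge0.
- exists 1 => _ [N _ <-]; apply: le_trans (s_le N) _.
  by rewrite gerBl exprn_ge0// invr_ge0.
- apply: ae_on_imp sE => t _ h; split.
    by move=> m n mn; rewrite !h; exact: ndG.
  by under eq_cvg do rewrite h; exact: Gg.
have := yfin v; rewrite ltNge => /negP; apply.
rewrite leye_eq; apply/eqP/eqyP => A _.
pose n := (Num.truncn A).+1.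
apply: (@le_trans _ _ n%:R%:E); first by rewrite lee_fin ltW// truncnS_gt.
have [_ zn] := zP n; apply: (le_trans zn); apply: pairing_le => //.
apply: ae_on_imp vE => t _ ->; rewrite !abseM; apply: lee_wpmul2r => //.
apply: (@le_trans _ _ (g t)); last exact: lee_abs.
apply: le_ereal_sup_tmp; exists (G n.+1 t); first by exists n.+1.
by rewrite /G big_ord_recr/= leeDr//; exact: sume_ge0.
Qed.

End AssociateSpace.

(** * Averages of unit blocks on the half line *)

Section BlockAverages.
Context {R : realType} (D : set R).
Hypothesis HD : D = `[0, 1[%classic \/ D = `[0, +oo[%classic.
Hypothesis Doo : D = `[0, +oo[%classic.
Local Notation mu := (@lebesgue_measure R).
Local Notation d := (distribution_function D).
Context (E : completeNormedModType R) (f : E -> R -> \bar R).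
Hypothesis symE : symmetric_space D f.
Let mD := measurable_interval HD.
Let bfsE := sym_bfs symE.
Implicit Types (x z : E).

Definition unit_block (j : nat) : set R := `[j%:R, j.+1%:R[%classic.

Lemma mem_unit_block j (t : R) : 0 <= t -> unit_block j t <-> Num.truncn t = j.
Proof.
move=> t0; rewrite /unit_block/= in_itv/=; split=> [jt|<-].
  by apply/eqP; rewrite truncn_eq.
by rewrite truncn_itv.
Qed.

Lemma interval_infinite : mu D = +oo%E.
Proof. by rewrite Doo lebesgue_measure_itv/= ltry oppr0 adde0. Qed.

Lemma rep_unit_block : exists e : nat -> E,
  forall j, ae_eq mu D (f (e j)) (EFin \o \1_(unit_block j)).
Proof.
suff /choice[e eE] : forall j : nat, exists e,
    ae_eq mu D (f e) (EFin \o \1_(unit_block j)) by exists e.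
move=> j.
have [c cE] := rep_chi_initial_segment HD symE j.+1%:R.
have mB : measurable (unit_block j) by exact: measurable_itv.
exists (restr D f (unit_block j) c).
apply: ae_on_imp2 (restrE HD symE c mB) cE => t Dt -> /= ft.
rewrite patchE ft !indicE; case: ifPn => [/set_mem tB|_] //=.
rewrite mem_set//; split; first exact: interval_ge0 Dt.
by move: tB; rewrite /unit_block/= in_itv/= lte_fin => /andP[].
Qed.

Variable e : nat -> E.
Hypothesis eE : forall j, ae_eq mu D (f (e j)) (EFin \o \1_(unit_block j)).

Definition step (M : nat) (c : 'I_M -> R) (t : R) : R :=
  \sum_(j < M) c j * \1_(unit_block j) t.

Lemma step_block M (c : 'I_M -> R) (i : 'I_M) t : 0 <= t ->
  Num.truncn t = i -> step c t = c i.
Proof.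
move=> t0 ti; rewrite /step (bigD1 i)//= indicE mem_set ?mulr1; last first.
  exact/mem_unit_block.
rewrite big1 ?addr0// => j ji; rewrite indicE memNset ?mulr0//.
move/(mem_unit_block _ t0) => tj; move: ji; rewrite -val_eqE/=.
by rewrite -tj ti eqxx.
Qed.

Lemma step_out M (c : 'I_M -> R) t : 0 <= t -> (M <= Num.truncn t)%N ->
  step c t = 0.
Proof.
move=> t0 Mt; rewrite /step big1// => j _; rewrite indicE memNset ?mulr0//.
move/(mem_unit_block _ t0) => tj; move: Mt; rewrite tj leqNgt.
by rewrite ltn_ord.
Qed.

Lemma measurable_step M (c : 'I_M -> R) : L0 D (EFin \o step c).
Proof.
apply/measurable_EFinP; apply: measurable_sum => j.
by apply: measurable_funM => //; apply: measurable_indic; exact: measurable_itv.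
Qed.

(** Each block has measure 1, so the distribution counts the coefficients above [l]; in particular
    it does not see their order. *)
Lemma distribution_step M (c : 'I_M -> R) l : (forall j, 0 <= c j) -> 0 <= l ->
  (d (EFin \o step c) l = \sum_(j < M) (l < c j)%R%:R%:E)%E.
Proof.
move=> c0 l0; have ms := measurable_step c.
have mA := measurable_superlevel HD l ms.
have mB j : measurable (unit_block j) by exact: measurable_itv.
pose F (j : 'I_M) t : \bar R := ((l < c j)%R%:R * \1_(unit_block j) t)%:E.
transitivity (\int[mu]_(t in D) (\sum_(j < M) F j t))%E.
  rewrite /distribution_function -[in LHS](setIidl (@subIsetl _ D _)).
  rewrite -integral_indic//; apply: eq_integral => t /set_mem Dt.
  have t0 := interval_ge0 HD Dt.
  rewrite /F sumEFin; congr EFin.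
  have -> : \sum_(j < M) (l < c j)%R%:R * \1_(unit_block j) t =
      step (fun j : 'I_M => (l < c j)%R%:R) t by [].
  have [tM|Mt] := ltnP (Num.truncn t) M.
    rewrite (@step_block _ _ (Ordinal tM))//.
    have [h|h] := boolP (l < c (Ordinal tM)).
      rewrite indicE mem_set//; split=> //=.
      by rewrite (@step_block _ _ (Ordinal tM))// lte_fin ger0_norm.
    rewrite indicE memNset// => -[_ /=].
    by rewrite (@step_block _ _ (Ordinal tM))// lte_fin ger0_norm//; exact/negP.
  rewrite step_out// indicE memNset//= => -[_ /=].
  by rewrite step_out// normr0 lte_fin ltNge l0.
rewrite ge0_integral_sum//; last 2 first.
- move=> j; apply/measurable_EFinP; apply: measurable_funM => //.
  by apply: measurable_indic; exact: mB.
- by move=> j t _; rewrite lee_fin mulr_ge0.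
apply: eq_bigr => j _; rewrite /F.
under eq_integral do rewrite EFinM.
rewrite ge0_integralZl_EFin//; last first.
  by apply/measurable_EFinP; by apply: measurable_indic; exact: mB.
rewrite integral_indic//; last exact: mB.
rewrite (_ : unit_block j `&` D = unit_block j); last first.
  apply: setIidl => t; rewrite /unit_block Doo/= !in_itv/= andbT => /andP[jt _].
  exact: le_trans jt.
have muB : mu (unit_block j) = 1%E.
  by rewrite lebesgue_measure_itv/= lte_fin ltr_nat leqnn -EFinB -natrB// subSnn.
by rewrite [X in (_ * X)%E]muB mule1.
Qed.

Lemma rep_step M (c : 'I_M -> R) :
  ae_eq mu D (f (\sum_(j < M) c j *: e j)) (EFin \o step c).
Proof.
have h : {ae mu, forall t, forall j : 'I_M,
    D t -> f (c j *: e j) t = (c j * \1_(unit_block j) t)%:E}.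
  apply: (@filter_forall _ _ _ (almost_everywhere mu) (ae_filter_ringOfSetsType mu)) => j.
  apply: ae_on_imp2 (bfs_scale bfsE (c j) (e j)) (eE j) => t _ -> -> /=.
  by rewrite EFinM.
apply: (@filterS2 _ (almost_everywhere mu)) h
  (rep_sum symE (index_enum 'I_M) predT (fun j => c j *: e j)) => t h1 h2 Dt.
by rewrite h2//= /step -sumEFin; apply: eq_bigr => j _; exact: h1.
Qed.

(** Addition in ['I_M.+1] is cyclic, so the shift permutes the coefficients and preserves the
    distribution. *)
Lemma norm_step_shift M (c : 'I_M.+1 -> R) r : (forall j, 0 <= c j) ->
  `|\sum_(j < M.+1) c (j + r) *: e j| = `|\sum_(j < M.+1) c j *: e j|.
Proof.
move=> c0; apply: (norm_equimeasurable symE) => l.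
have [l0|l0] := ltP l 0; first by rewrite !distribution_lt0.
rewrite !(ae_eq_distribution HD (rep_measurable symE _) (measurable_step _) (rep_step _)).
by rewrite !distribution_step// [RHS](reindex_inj (addIr r)).
Qed.

(* The M+1 cyclic shifts of the coefficients give equimeasurable functions
   whose sum is constant. *)
Lemma block_average M (c : 'I_M.+1 -> R) : (forall j, 0 <= c j) ->
  (\sum_j c j) * `|\sum_(j < M.+1) e j| <=
  M.+1%:R * `|\sum_(j < M.+1) c j *: e j|.
Proof.
move=> c0.
have -> : M.+1%:R * `|\sum_(j < M.+1) c j *: e j| =
    \sum_(r < M.+1) `|\sum_(j < M.+1) c (j + r) *: e j|.
  rewrite (eq_bigr (fun=> `|\sum_(j < M.+1) c j *: e j|)); last first.
    by move=> r _; exact: norm_step_shift.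
  by rewrite sumr_const card_ord mulr_natl.
apply: le_trans (ler_norm_sum _ _ _).
rewrite -[X in X * _]ger0_norm ?sumr_ge0// -normrZ exchange_big/=.
rewrite le_eqVlt; apply/orP; left; apply/eqP; congr `|_|.
rewrite scaler_sumr; apply: eq_bigr => j _; rewrite -scaler_suml.
by congr (_ *: _); rewrite (reindex_inj (addrI j)).
Qed.

Definition block_mean (n : nat) : E := n.+1%:R^-1 *: \sum_(j < n.+1) e j.

(** On the common blocks 0, ..., M each mean is a step function with coefficients of sum 1, so the
    coefficients of the sum add up to the cardinal of [I], and [block_average] applies. *)
Lemma block_mean_sum (I : finType) (n : I -> nat) (M : nat) :
  (forall i, (n i <= M)%N) ->
  #|I|%:R * `|block_mean M| <= `|\sum_i block_mean (n i)|.
Proof.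
move=> nM.
pose u i (j : 'I_M.+1) : R := if (j < (n i).+1)%N then (n i).+1%:R^-1 else 0.
have uE i : block_mean (n i) = \sum_(j < M.+1) u i j *: e j.
  rewrite /block_mean scaler_sumr
    (big_ord_widen _ (fun j => (n i).+1%:R^-1 *: e j) (nM i : ((n i).+1 <= M.+1)%N)).
  rewrite big_mkcond/=; apply: eq_bigr => j _; rewrite /u.
  by case: ifP => // _; rewrite scale0r.
have u1 i : \sum_(j < M.+1) u i j = 1.
  rewrite /u -big_mkcond/=
    -(big_ord_widen _ (fun=> (n i).+1%:R^-1) (nM i : ((n i).+1 <= M.+1)%N)).
  by rewrite sumr_const card_ord -[LHS]mulr_natr mulVf.
rewrite (eq_bigr _ (fun i _ => uE i)) exchange_big/=.
under [X in _ <= `|X|]eq_bigr do rewrite -scaler_suml.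
have u0 j : 0 <= \sum_i u i j.
  by apply: sumr_ge0 => i _; rewrite /u; case: ifP.
have := block_average u0.
rewrite exchange_big/= (eq_bigr _ (fun i _ => u1 i)) sumr_const => h.
rewrite /block_mean normrZ gtr0_norm ?invr_gt0// mulrCA.
by rewrite ler_pdivrMl.
Qed.

Lemma rep_block_sum N :
  ae_eq mu D (f (\sum_(j < N) e j)) (EFin \o \1_(initial_segment N%:R%:E)).
Proof.
have -> : \sum_(j < N) e j = \sum_(j < N) (1 : R) *: e j.
  by apply: eq_bigr => j _; rewrite scale1r.
apply: ae_on_imp (rep_step (fun _ : 'I_N => 1)) => t Dt -> /=.
have t0 := interval_ge0 HD Dt; congr EFin; rewrite indicE.
have [tN|Nt] := ltnP (Num.truncn t) N.
  rewrite (@step_block _ _ (Ordinal tN))// mem_set//; split=> //.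
  by rewrite lte_fin (lt_le_trans (truncnS_gt t))// ler_nat.
rewrite step_out// memNset// => -[_]; rewrite lte_fin; apply/negP; rewrite -leNgt.
apply: le_trans (_ : (Num.truncn t)%:R <= t); first by rewrite ler_nat.
by have /andP[] := truncn_itv t0.
Qed.

Lemma block_mean_cone n : decreasing_cone D f (block_mean n).
Proof.
apply: (cone_scale HD symE); first by rewrite invr_gt0.
have mS := measurable_initial_segment (n.+1%:R%:E : \bar R).
have SD : D `&` initial_segment n.+1%:R%:E = initial_segment n.+1%:R%:E.
  by apply: (interval_initial_segment_le HD); rewrite interval_infinite leey.
pose h : R -> \bar R := EFin \o \1_(initial_segment n.+1%:R%:E).
pose delta (l : R) : \bar R := if l < 1 then n.+1%:R%:E else 0%E.
have h0 t : D t -> (0 <= h t)%E by move=> _; rewrite lee_fin.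
have d0 l : 0 <= l -> (0 <= delta l <= mu D)%E.
  by move=> _; rewrite interval_infinite leey andbT /delta; case: ifP.
have hd t l : D t -> 0 <= l -> (l%:E < h t)%E = (t%:E < delta l)%E.
  move=> Dt l0; have t0 := interval_ge0 HD Dt; rewrite /h /delta /= indicE lte_fin.
  have [tn|nt] := boolP (t%:E < n.+1%:R%:E)%E.
    rewrite mem_set//=; case: ifPn => [_|_]; first by rewrite tn.
    by rewrite lte_fin ltNge t0.
  rewrite memNset/=; last by case=> _; apply/negP.
  rewrite ltNge l0/=; case: ifPn => [_|_]; first by rewrite (negbTE nt).
  by rewrite lte_fin ltNge t0.
apply: (cone_rearrangement HD symE (h := h)).
- exact: profile_measurable h0 d0 hd.
- exact: rep_block_sum.
- exact: profile_rearrangement h0 d0 hd.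
Qed.

(** On a fixed segment the mean is at most 1/(n+1), hence tends to 0 there as [n] grows. *)
Lemma head_block_mean (m n : nat) :
  `|restr D f (initial_segment m%:R%:E) (block_mean n)| <=
  n.+1%:R^-1 * `|\sum_(j < m) e j|.
Proof.
rewrite -[n.+1%:R^-1]ger0_norm ?invr_ge0// -normrZ; apply: (norm_le symE).
have mS := measurable_initial_segment (m%:R%:E : \bar R).
have h1 : ae_eq mu D (f (block_mean n))
    (fun t => (n.+1%:R^-1)%:E * (\1_(initial_segment n.+1%:R%:E) t)%:E)%E.
  by apply: ae_on_imp2 (bfs_scale bfsE n.+1%:R^-1 (\sum_(j < n.+1) e j))
    (rep_block_sum n.+1) => t _ -> ->.
have h2 : ae_eq mu D (f (n.+1%:R^-1 *: \sum_(j < m) e j))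
    (fun t => (n.+1%:R^-1)%:E * (\1_(initial_segment m%:R%:E) t)%:E)%E.
  by apply: ae_on_imp2 (bfs_scale bfsE n.+1%:R^-1 (\sum_(j < m) e j))
    (rep_block_sum m) => t _ -> ->.
apply: ae_on_imp3 (restrE HD symE (block_mean n) mS) h1 h2 => t _ -> h ->.
rewrite patchE h !indicE; case: ifPn => // [_|_]; rewrite ?abse0//.
rewrite -!EFinM !abse_EFin lee_fin !ger0_norm ?mulr_ge0 ?invr_ge0//.
by rewrite ler_wpM2l ?invr_ge0//; case: (_ \in _).
Qed.

Section InfiniteLevels.
Variable k : nat.
Hypothesis rotE : compactly_fully_rotund k (decreasing_cone D f).
Hypothesis fatouE : fatou_property D f.

(** This is [block_mean_sum] for one summand. *)
Lemma block_mean_nonincreasing : nonincreasing_seq (fun n => `|block_mean n|).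
Proof.
move=> m n mn; have := @block_mean_sum 'I_1 (fun=> m) n (fun=> mn).
by rewrite card_ord mul1r big_ord1.
Qed.

(* If the means stayed away from 0, rotundity would give them a nonzero cluster
   point, although they tend to 0 on every bounded interval. *)
Lemma block_mean_not_bounded_below a : 0 < a ->
  ~ forall n, a <= `|block_mean n|.
Proof.
move=> a0 an.
have ulb : has_lbound (range (fun n => `|block_mean n|)).
  by exists a => _ [n _ <-]; exact: an.
have ucvg := nonincreasing_cvgn block_mean_nonincreasing ulb.
set L := inf _ in ucvg.
have aL : a <= L.
  by apply: lb_le_inf; [exists `|block_mean 0|, 0%N|move=> _ [n _ <-]].
have L0 := lt_le_trans a0 aL.
have [e' e'0|z hz] := rotund_cluster HD symE rotE L0 block_mean_cone ucvg.
  exists 0%N => n _.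
  (* The sum of all chosen indices serves as the common bound [M] of [block_mean_sum]. *)
  have nM i : (n i <= \sum_j n j)%N by rewrite (bigD1 i)//= leq_addr.
  apply: le_trans (block_mean_sum nM); rewrite card_ord.
  rewrite lerBlDr; apply: (@le_trans _ _ (k%:R * `|block_mean (\sum_j n j)|)).
    by rewrite ler_wpM2l//; apply: ge_inf => //; exists (\sum_j n j)%N.
  by rewrite lerDl ltW.
suff z0 : z = 0.
  by have [n _] := hz a a0 0%N; rewrite z0 subr0 ltNge an.
have mS n := measurable_initial_segment (n%:R%:E : \bar R).
apply: (restr_bigcup0 HD symE (A := fun n => initial_segment n%:R%:E)) => //.
  apply: ae_onW => t Dt; exists (Num.truncn t).+1; split; first exact: interval_ge0 Dt.
  by rewrite lte_fin truncnS_gt.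
move=> m; apply/normr0_eq0/eqP; rewrite eq_le normr_ge0 andbT.
apply/ler_addgt0Pr => e' e'0; rewrite add0r.
have e'2 : 0 < e' / 2 by rewrite divr_gt0.
set c := `|\sum_(j < m) e j|.
have [n mn hn] := hz _ e'2 (Num.truncn (c / (e' / 2))).
have hc : n.+1%:R^-1 * c <= e' / 2.
  rewrite ler_pdivrMl// mulrC -ler_pdivrMl// mulrC.
  by apply: le_trans (ltW (truncnS_gt _)) _; rewrite ler_nat.
have -> : restr D f (initial_segment m%:R%:E) z =
    restr D f (initial_segment m%:R%:E) (block_mean n) -
    restr D f (initial_segment m%:R%:E) (block_mean n - z).
  by rewrite (restrB HD symE _ _ (mS m)) opprB addrC subrK.
apply: le_trans (ler_normB _ _) _; rewrite [e']splitr; apply: lerD.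
  exact: le_trans (head_block_mean m n) hc.
exact: le_trans (norm_restr_le HD symE _ (mS m)) (ltW hn).
Qed.

(** A set of infinite measure where |y| > l has bounded pieces of arbitrarily large measure m, whose
    indicators have norm at least l m / C by [associate_bound]. Comparison with floor(m) + 1 unit
    blocks then bounds the means below. *)
Lemma associate_level_finite y l : associate_space D f y -> 0 < l ->
  (d y l < +oo)%E.
Proof.
move=> yA l0; have [my _] := yA; have [C C0 hC] := associate_bound HD symE fatouE yA.
rewrite ltey; apply/eqP => dy.
pose A := D `&` [set s | (l%:E < `|y s|)%E].
have mA : measurable A by exact: measurable_superlevel.
have mS n := measurable_initial_segment (n%:R%:E : \bar R).
pose A_ (n : nat) := A `&` initial_segment n%:R%:E.
have mA_ n : measurable (A_ n) by exact: measurableI.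
have A_cvg : mu (A_ n) @[n --> \oo] --> +oo%E.
  have -> : +oo%E = mu (\bigcup_n A_ n).
    rewrite -setI_bigcupr -dy; congr (mu _); apply/esym/setIidl => t [Dt _].
    exists (Num.truncn t).+1 => //; split; first exact: interval_ge0 Dt.
    by rewrite lte_fin truncnS_gt.
  apply: nondecreasing_cvg_mu => //; first exact: bigcupT_measurable.
  move=> n m nm; apply/subsetPset; apply: setIS.
  by apply: initial_segment_subset; rewrite lee_fin ler_nat.
(* The factor 2 absorbs the passage from N to N + 1 blocks: N + 1 <= 2 N once N >= 1. *)
apply: (@block_mean_not_bounded_below (l / (2 * C))).
  by rewrite divr_gt0// mulr_gt0.
move=> n.
have [s hs] : exists s, (n.+1%:R%:E <= mu (A_ s))%E.
  move/cvgeyPge : A_cvg => /(_ n.+1%:R)[s _ h].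
  by exists s; exact: h s (leqnn s).
have As_fin : mu (A_ s) \is a fin_num.
  rewrite ge0_fin_numE ?measure_ge0//; apply: (@le_lt_trans _ _ s%:R%:E); last by rewrite ltry.
  rewrite -[leRHS]lebesgue_measure_initial_segment ?lee_fin//.
  by apply: le_lebesgue_measure => //; exact: subIsetr.
pose m := fine (mu (A_ s)); pose N := Num.truncn m.
have mE : mu (A_ s) = m%:E by rewrite fineK.
have nm : n.+1%:R <= m by rewrite -lee_fin -mE.
have m0 : 0 <= m by exact: le_trans nm.
have Nm : N%:R <= m by have /andP[] := truncn_itv m0.
have mN : m < N.+1%:R by exact: truncnS_gt.
have nN : (n.+1 <= N)%N.
  by rewrite -ltnS -(ltr_nat R); exact: le_lt_trans mN.
have [|z zE zN] := rep_distribution_le HD symE (y := \sum_(j < N.+1) e j)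
    (measurable_chi (mA_ s)).
  move=> l' l'0.
  rewrite [leRHS](ae_eq_distribution HD (rep_measurable symE _)
    (measurable_chi (mS N.+1)) (rep_block_sum N.+1)).
  rewrite !distribution_chi//; case: ifP => // _.
  have -> : D `&` initial_segment N.+1%:R%:E = initial_segment N.+1%:R%:E.
    by apply: (interval_initial_segment_le HD); rewrite interval_infinite leey.
  rewrite lebesgue_measure_initial_segment ?lee_fin//.
  apply: (@le_trans _ _ (mu (A_ s))); last by rewrite mE lee_fin ltW.
  by apply: le_lebesgue_measure => //; exact: measurableI.
have lm : (l * m <= C * `|z|).
  rewrite -lee_fin; apply: le_trans (hC z).
  have -> : (l * m)%:E = (\int[mu]_(t in D) (l%:E * (\1_(A_ s) t)%:E))%E.
    rewrite ge0_integralZl//; last by rewrite lee_fin ltW.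
    - rewrite integral_indic//; last exact: mA_.
      rewrite (_ : A_ s `&` D = A_ s); last by apply/setIidl => t [[]].
      by rewrite EFinM -mE.
    - by apply/measurable_EFinP; apply: measurable_indic; exact: mA_.
  apply: ae_ge0_le_integral => //.
  - by move=> t _; rewrite mule_ge0// lee_fin ltW.
  - apply: measurable_funeM; apply/measurable_EFinP.
    by apply: measurable_indic; exact: mA_.
  - exact: measurable_pairing.
  apply: ae_on_imp zE => t Dt ->; rewrite /= indicE.
  have [/set_mem[[_ /= lt] _]|_] := boolP (t \in A_ s).
    by rewrite mule1 mul1e ltW.
  by rewrite mule0 mul0e abse0.
have zbm : `|z| <= N.+1%:R * `|block_mean N|.
  by rewrite /block_mean normrZ gtr0_norm ?invr_gt0// mulrA mulfV// mul1r.
apply: (@le_trans _ _ `|block_mean N|); last first.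
  by apply: block_mean_nonincreasing; exact: ltnW.
rewrite ler_pdivrMr ?mulr_gt0//.
have N1 : 1 <= N%:R :> R by rewrite ler1n; exact: leq_ltn_trans nN.
have h : l * N%:R <= C * (N.+1%:R * `|block_mean N|).
  apply: le_trans (le_trans lm _); first by rewrite ler_wpM2l// ltW.
  by rewrite ler_wpM2l// ltW.
have N0 : 0 < N%:R :> R by exact: lt_le_trans N1.
rewrite -(ler_pM2r N0); apply: le_trans h _.
rewrite -[N.+1%:R]natr1.
have b0 : 0 <= C * `|block_mean N| by rewrite mulr_ge0// ltW.
have -> : C * ((N%:R + 1) * `|block_mean N|) = (C * `|block_mean N|) * (N%:R + 1) by ring.
have -> : `|block_mean N| * (2 * C) * N%:R = (C * `|block_mean N|) * (N%:R + N%:R) by ring.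
by rewrite ler_wpM2l// lerD2l.
Qed.

End InfiniteLevels.
End BlockAverages.

(** * Pairing with tail suprema of rearrangements *)

Section AssociateOrderContinuity.
Context {R : realType} (D : set R).
Hypothesis HD : D = `[0, 1[%classic \/ D = `[0, +oo[%classic.
Local Notation mu := (@lebesgue_measure R).
Local Notation d := (distribution_function D).
Local Notation rearr := (rearrangement D).
Context (E : completeNormedModType R) (f : E -> R -> \bar R).
Hypothesis symE : symmetric_space D f.
Variable k : nat.
Hypothesis rotE : compactly_fully_rotund k (decreasing_cone D f).
Hypothesis fatouE : fatou_property D f.
Let mD := measurable_interval HD.
Let bfsE := sym_bfs symE.
Implicit Types (x z : E) (y w : R -> \bar R).

Lemma associate_distribution_finite y l : associate_space D f y -> 0 < l ->
  (d y l < +oo)%E.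
Proof.
move=> yA l0; have [my _] := yA; rewrite ltey; apply/eqP => dy.
have Doo := distribution_infinite HD my l0 dy.
have [e eE] := rep_unit_block HD symE.
have := associate_level_finite HD Doo symE eE rotE fatouE yA l0.
by rewrite dy ltxx.
Qed.

(** The representative of x - x is 0 almost everywhere, whereas the difference of two equal infinite
    values in [\bar R] is infinite. *)
Lemma rep_finite x : {ae mu, forall t, D t -> f x t \is a fin_num}.
Proof.
have := repB symE x x; rewrite subrr => h.
apply: ae_on_imp2 h (rep0 symE) => t _ -> /=.
by case: (f x t).
Qed.

(** The product with a weak unit is integrable, hence finite almost everywhere, and the weak unit is
    positive. *)
Lemma associate_finite y : associate_space D f y ->
  {ae mu, forall t, D t -> (`|y t| < +oo)%E}.
Proof.
move=> [my yfin]; have [w w0] := bfs_weak_unit bfsE.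
have : {ae mu, forall t, D t -> `|f w t * y t|%E \is a fin_num}.
  apply: integrable_ae => //; apply/integrableP; split.
    exact: measurable_pairing.
  by under eq_integral do rewrite abse_id; exact: yfin.
apply: ae_on_imp2 w0 => t _ wt; rewrite abseM ltey; apply: contraPneq => ->.
by rewrite gt0_muley// gee0_abs// ltW.
Qed.

(** [resonance] replaces the rearranged pairing by a pairing of [y] with an element of norm at most
    |x|, at the cost of the factor 2e. *)
Lemma associate_rearrangement_bound y : associate_space D f y ->
  exists2 C, 0 < C & forall x,
    (\int[mu]_(t in D) (rearr (f x) t * rearr y t) <= (C * `|x|)%:E)%E.
Proof.
move=> yA; have [my _] := yA; have [C C0 hC] := associate_bound HD symE fatouE yA.
exists (2 * expR 1 * C); first by rewrite !mulr_gt0// expR_gt0.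
move=> x; have [v [mv v0 vx hv]] := resonance HD my (rep_measurable symE x)
  (associate_finite yA) (fun l => associate_distribution_finite yA (l := l)).
have [z zE zx] := rep_distribution_le HD symE mv vx.
apply: (le_trans hv).
have -> : ((2 * expR 1 * C * `|x|)%:E = (2 * expR 1)%:E * (C * `|x|)%:E)%E.
  by rewrite -EFinM mulrA.
apply: lee_wpmul2l.
  by rewrite lee_fin mulr_ge0// expR_ge0.
apply: le_trans (_ : (C * `|z|)%:E <= _)%E; last by rewrite lee_fin ler_wpM2l// ltW.
apply: le_trans (hC z); apply: ae_ge0_le_integral => //.
- by apply: measurableT_comp => //; exact: emeasurable_funM.
- exact: measurable_pairing.
- by apply: ae_on_imp zE => t _ ->.
Qed.

Section Witness.
Variables (y : R -> \bar R) (y_ : nat -> R -> \bar R).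
Hypothesis yA : associate_space D f y.
Hypothesis y_A : forall n, associate_space D f (y_ n).
Hypothesis y_ge0 : forall n, {ae mu, forall t, D t -> (0 <= y_ n t)%E}.
Hypothesis y_le : forall n, {ae mu, forall t, D t -> (y_ n t <= `|y t|)%E}.
Hypothesis y_0 : {ae mu, forall t, D t -> y_ n t @[n --> \oo] --> 0%E}.

Let my : L0 D y. Proof. by case: yA. Qed.
Let my_ n : L0 D (y_ n). Proof. by case: (y_A n). Qed.

Let y_le' n : {ae mu, forall t, D t -> (`|y_ n t| <= `|y t|)%E}.
Proof.
by apply: ae_on_imp2 (y_ge0 n) (y_le n) => t _ h1 h2; rewrite (gee0_abs h1).
Qed.

(* The supremum is taken after rearranging, so that it is again decreasing. *)
Definition rearrangement_tail (n : nat) (t : R) : \bar R :=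
  ereal_sup [set rearr (y_ m) t | m in [set m | (n <= m)%N]].
Local Notation W := rearrangement_tail.

Lemma rearrangement_tail_ge0 n t : (0 <= W n t)%E.
Proof.
apply: le_ereal_sup_tmp; exists (rearr (y_ n) t); first by exists n => /=.
exact: rearrangement_ge0.
Qed.

Lemma rearrangement_tail_nonincreasing m n t : (m <= n)%N -> (W n t <= W m t)%E.
Proof.
move=> mn; apply: ereal_sup_le => _ [p /= np <-]; exists p => //=.
exact: leq_trans np.
Qed.

Lemma rearrangement_tail_le n t : (W n t <= rearr y t)%E.
Proof.
apply: ge_ereal_sup => _ [m _ <-]; apply: le_rearrangement => // l l0.
exact: ae_le_distribution.
Qed.

(** A supremum exceeds a level exactly when some term does, so the supremum of the distribution
    functions describes the level sets of [W n]. *)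
Let delta n l : \bar R := ereal_sup [set d (y_ m) l | m in [set m | (n <= m)%N]].

Let tail_delta0 n l : 0 <= l -> (0 <= delta n l <= mu D)%E.
Proof.
move=> l0; apply/andP; split.
  apply: le_ereal_sup_tmp; exists (d (y_ n) l); first by exists n => /=.
  exact: distribution_ge0.
by apply: ge_ereal_sup => _ [m _ <-]; exact: distribution_le.
Qed.

Let tail_delta n t l : D t -> 0 <= l -> (l%:E < W n t)%E = (t%:E < delta n l)%E.
Proof.
move=> Dt l0; apply/ereal_sup_gtP/ereal_sup_gtP => -[_ [m nm <-]] h.
  by exists (d (y_ m) l); [exists m|rewrite -rearrangement_gt].
by exists (rearr (y_ m) t); [exists m|rewrite rearrangement_gt].
Qed.

Lemma measurable_rearrangement_tail n : L0 D (W n).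
Proof.
apply: (profile_measurable HD (delta := delta n)) => *.
- exact: rearrangement_tail_ge0.
- exact: tail_delta0.
- exact: tail_delta.
Qed.

Lemma rearrangement_tailK n t : D t -> rearr (W n) t = W n t.
Proof.
move=> Dt; apply: (profile_rearrangement HD (delta := delta n)) => // *.
- exact: rearrangement_tail_ge0.
- exact: tail_delta0.
- exact: tail_delta.
Qed.

(** Once the sets where |y_m| > e have measure below [t] for all m >= N, every rearrangement from
    [N] on is at most [e] at [t], and so is their supremum. *)
Lemma rearrangement_tail_cvg0 t : 0 < t -> W n t @[n --> \oo] --> 0%E.
Proof.
move=> t0; apply: cvge0_eventually_le => [n|e e0]; first exact: rearrangement_tail_ge0.
have t0' : (0 < t%:E)%E by rewrite lte_fin.
have [N hN] := cvge_lt_eventually (distribution_cvg0 HD e0 my my_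
  (associate_distribution_finite yA e0) y_le' y_0) t0'.
exists N => n Nn; apply: ge_ereal_sup => _ [m /= nm <-].
rewrite rearrangement_le ?(ltW e0)//; apply/ltW/hN.
exact: leq_trans nm.
Qed.

Definition tail_pairing n x : \bar R := (\int[mu]_(t in D) `|f x t * W n t|)%E.
Local Notation J := tail_pairing.

Lemma tail_pairing_ge0 n x : (0 <= J n x)%E.
Proof. exact: integral_ge0. Qed.

Let star_pairing n x z : ae_eq mu D (f z) (rearr (f x)) ->
  (\int[mu]_(t in D) (rearr (f x) t * W n t))%E = J n z.
Proof.
move=> zE; have mW := measurable_rearrangement_tail n.
have mx := measurable_rearrangement HD (rep_measurable symE x).
apply: ge0_ae_eq_integral => //.
- by apply: emeasurable_funM.
- exact: measurable_pairing.
- by move=> t _; rewrite mule_ge0 ?rearrangement_ge0 ?rearrangement_tail_ge0.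
- apply: ae_on_imp zE => t _ ->; rewrite gee0_abs//.
  by rewrite mule_ge0 ?rearrangement_ge0 ?rearrangement_tail_ge0.
Qed.

Lemma pairing_le_tail n x : exists z, [/\ decreasing_cone D f z, `|z| = `|x| &
  (\int[mu]_(t in D) `|f x t * y_ n t| <= J n z)%E].
Proof.
have [z [zE zx zcone]] := rep_star HD symE x; exists z; split=> //.
have mx := rep_measurable symE x.
apply: le_trans (hardy_littlewood HD mx (my_ n)) _.
rewrite -(star_pairing n zE); apply: ge0_le_integral => //.
- by move=> t _; rewrite mule_ge0// rearrangement_ge0.
- by apply: emeasurable_funM; exact: measurable_rearrangement.
- apply: emeasurable_funM; first exact: measurable_rearrangement.
  exact: measurable_rearrangement_tail.
- move=> t _; apply: lee_wpmul2l; first exact: rearrangement_ge0.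
  by apply: ereal_sup_ubound; exists n => /=.
Qed.

(** Near-maximizers of the functional can therefore be taken in the cone. Since [W n] is its own
    rearrangement on [D], Hardy-Littlewood gives back a pairing with [W n]. *)
Lemma tail_pairing_star n x : exists z, [/\ decreasing_cone D f z, `|z| = `|x| &
  (J n x <= J n z)%E].
Proof.
have [z [zE zx zcone]] := rep_star HD symE x; exists z; split=> //.
have mx := rep_measurable symE x; have mW := measurable_rearrangement_tail n.
apply: le_trans (hardy_littlewood HD mx mW) _.
rewrite -(star_pairing n zE) le_eqVlt; apply/orP; left; apply/eqP.
by apply: eq_integral => t /set_mem Dt; rewrite rearrangement_tailK.
Qed.

Lemma tail_pairing_nonincreasing m n x : (m <= n)%N -> (J n x <= J m x)%E.
Proof.
move=> mn; apply: (pairing_le HD symE); [exact: measurable_rearrangement_tail..|].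
apply: ae_onW => t _; rewrite !abseM; apply: lee_wpmul2l => //.
rewrite !gee0_abs ?rearrangement_tail_ge0//.
exact: rearrangement_tail_nonincreasing.
Qed.

Let rep_pairing_bound : exists2 C, 0 < C & forall x,
  (\int[mu]_(t in D) `|f x t * rearr y t| <= (C * `|x|)%:E)%E.
Proof.
have [C C0 hC] := associate_rearrangement_bound yA; exists C => // x.
apply: le_trans (hC x); have mry := measurable_rearrangement HD my.
apply: le_trans (hardy_littlewood HD (rep_measurable symE x) mry) _.
by rewrite rearrangementK.
Qed.

Let tail_abs_le n x t :
  (`|f x t * W n t| <= `|f x t * rearr y t|)%E.
Proof.
rewrite !abseM; apply: lee_wpmul2l => //.
by rewrite !gee0_abs ?rearrangement_tail_ge0 ?rearrangement_ge0 ?rearrangement_tail_le.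
Qed.

Lemma tail_pairing_bound : exists2 C, 0 < C & forall n x, (J n x <= (C * `|x|)%:E)%E.
Proof.
have [C C0 hC] := rep_pairing_bound; exists C => // n x.
apply: le_trans (hC x); apply: pairing_le => //.
- exact: measurable_rearrangement_tail.
- exact: measurable_rearrangement.
- by apply: ae_onW => t _; exact: tail_abs_le.
Qed.

(** Dominated convergence; the majorant is the product of [f x] with the rearrangement of [y],
    integrable by [rep_pairing_bound]. *)
Lemma tail_pairing_cvg0 x : J n x @[n --> \oo] --> 0%E.
Proof.
have [C _ hC] := rep_pairing_bound.
have mry := measurable_rearrangement HD my.
have [|||||_ _] := @dominated_convergence _ _ _ mu D mD
  (fun n t => `|f x t * W n t|%E) (cst 0%E) (fun t => `|f x t * rearr y t|%E).
- move=> n; apply: measurable_pairing => //.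
  exact: measurable_rearrangement_tail.
- exact: measurable_cst.
- apply: ae_on_imp2 (rep_finite x) (ae_neq0 D) => t Dt fx t0.
  have t_gt0 : 0 < t by rewrite lt_neqAle eq_sym t0/=; exact: interval_ge0 Dt.
  have := cvgeZl fx (rearrangement_tail_cvg0 t_gt0); rewrite mule0 => h.
  by rewrite -(@abse0 R); exact: cvg_abse.
- apply/integrableP; split; first exact: measurable_pairing.
  under eq_integral do rewrite abse_id.
  by apply: le_lt_trans (hC x) _; rewrite ltry.
- apply: aeW => t n _; rewrite abse_id.
  exact: tail_abs_le.
by rewrite integral_cst// mul0e.
Qed.

End Witness.
End AssociateOrderContinuity.

(** * Order continuity of the associate space *)

Section AssociateTheorem.
Context {R : realType} (D : set R).
Hypothesis HD : D = `[0, 1[%classic \/ D = `[0, +oo[%classic.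
Local Notation mu := (@lebesgue_measure R).
Context (E : completeNormedModType R) (f : E -> R -> \bar R).
Hypothesis symE : symmetric_space D f.
Variable k : nat.
Hypothesis rotE : compactly_fully_rotund k (decreasing_cone D f).
Hypothesis fatouE : fatou_property D f.
Let mD := measurable_interval HD.
Let bfsE := sym_bfs symE.
Implicit Types (x z : E) (w : R -> \bar R).

Lemma pairing_triangle x z w : L0 D w ->
  (\int[mu]_(t in D) `|f x t * w t| <=
   \int[mu]_(t in D) `|f (x - z)%R t * w t| + \int[mu]_(t in D) `|f z t * w t|)%E.
Proof.
move=> mw; have mp v := measurable_pairing symE v mw.
apply: (@le_trans _ _
  (\int[mu]_(t in D) (`|f (x - z)%R t * w t| + `|f z t * w t|))%E); last first.
  by rewrite (ge0_integralD mu mD _ (mp (x - z)%R) _ (mp z)).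
apply: ae_ge0_le_integral => //; first exact: (mp x).
- by move=> t _; rewrite adde_ge0.
- exact: (emeasurable_funD (mp _) (mp _)).
have := bfs_add bfsE (x - z) z; rewrite subrK.
apply: ae_on_imp => t _ ->; rewrite !abseM -ge0_muleDl//.
by apply: lee_wpmul2r => //; exact: lee_abs_add.
Qed.

(** For nonnegative terms the absolute value of the sum is the sum of the absolute values; this
    additivity turns lower bounds for each [x i] into one for the sum. *)
Lemma pairing_sum (I : finType) (x : I -> E) w : L0 D w ->
  (forall i, {ae mu, forall t, D t -> (0 <= f (x i) t)%E}) ->
  (\int[mu]_(t in D) `|f (\sum_i x i)%R t * w t| =
   \sum_i \int[mu]_(t in D) `|f (x i) t * w t|)%E.
Proof.
move=> mw x0; have mp v := measurable_pairing symE v mw.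
transitivity (\int[mu]_(t in D) (\sum_i `|f (x i) t * w t|))%E; last first.
  by rewrite (ge0_integral_sum mu mD (fun i => mp (x i))).
apply: ge0_ae_eq_integral => //; first exact: (mp (\sum_i x i)).
- by apply: emeasurable_sum => i; exact: (mp (x i)).
- by move=> t _; exact: sume_ge0.
have x0' : {ae mu, forall t, D t -> forall i, (0 <= f (x i) t)%E}.
  have := @filter_forall _ _ _ (almost_everywhere mu) (ae_filter_ringOfSetsType mu) x0.
  by apply: (@filterS _ (almost_everywhere mu)) => t h Dt i; exact: h.
apply: ae_on_imp2 x0' (rep_sum symE (index_enum I) predT x) => t _ h ->.
rewrite abseM gee0_abs ?sume_ge0//.
rewrite ge0_sume_distrl; last by move=> i _; exact: h.
by apply: eq_bigr => i _; rewrite abseM [`|f _ _|%E]gee0_abs.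
Qed.

Lemma associate_order_continuous :
  order_continuous D (associate_space D f) id (associate_norm D f).
Proof.
move=> y y_ yA y_A y_ge0 y_le y_0.
pose J := tail_pairing D f y_.
have mW n := measurable_rearrangement_tail HD y_A n.
have J_ni := tail_pairing_nonincreasing HD symE y_A.
have [C C0 JC] := tail_pairing_bound HD symE rotE fatouE yA y_A y_ge0 y_le.
have J_cvg0 := tail_pairing_cvg0 HD symE rotE fatouE yA y_A y_ge0 y_le y_0.
pose S n := [set J n x | x in [set x : E | `|x| <= 1]].
pose a n := ereal_sup (S n).
have a0 n : (0 <= a n)%E.
  apply: le_ereal_sup_tmp; exists (J n 0); first by exists 0 => //=; rewrite normr0.
  exact: tail_pairing_ge0.
have aC n : (a n <= C%:E)%E.
  apply: ge_ereal_sup => _ [x /= x1 <-]; apply: le_trans (JC n x) _.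
  by rewrite lee_fin ler_piMr// ltW.
have afin n : a n \is a fin_num by rewrite ge0_fin_numE// (le_lt_trans (aC n))// ltry.
have a_ni m n : (m <= n)%N -> (a n <= a m)%E.
  move=> mn; apply: ge_ereal_sup => _ [x /= x1 <-].
  apply: le_trans (J_ni _ _ x mn) _.
  by apply: ereal_sup_ubound; exists x.
have norm_a n : (associate_norm D f (y_ n) <= a n)%E.
  apply: ge_ereal_sup => _ [x /= x1 <-].
  have [z [_ zx h]] := pairing_le_tail HD symE y_A n x.
  apply: (le_trans h); apply: ereal_sup_ubound; exists z => //=.
  by rewrite zx.
have norm_ge0 n : (0 <= associate_norm D f (y_ n))%E.
  apply: le_ereal_sup_tmp.
  exists (\int[mu]_(t in D) `|f 0%R t * y_ n t|)%E; last exact: integral_ge0.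
  by exists 0 => //=; rewrite normr0.
suff a_small e : 0 < e -> exists N, (a N <= e%:E)%E.
  apply: cvge0_eventually_le => // e e0; have [N hN] := a_small e e0.
  by exists N => n Nn; apply: le_trans (le_trans (norm_a n) (a_ni _ _ Nn)) hN.
move=> e0; apply: contrapT => /forallNP noN.
pose alpha n := fine (a n).
have alphaE n : a n = (alpha n)%:E by rewrite fineK.
have alpha_e n : e <= alpha n.
  by rewrite -lee_fin -alphaE leNgt; apply/negP => h; apply: (noN n); exact: ltW.
have alpha_ni : nonincreasing_seq alpha.
  by move=> m n /a_ni; rewrite !alphaE lee_fin.
have alpha_lb : has_lbound (range alpha) by exists e => _ [n _ <-].
have alpha_cvg := nonincreasing_cvgn alpha_ni alpha_lb.
set b := inf _ in alpha_cvg.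
have eb : e <= b by apply: lb_le_inf; [exists (alpha 0%N), 0%N|move=> _ [n _ <-]].
have b0 : 0 < b by exact: lt_le_trans eb.
have b_alpha n : b <= alpha n by apply: ge_inf => //; exists n.
have alpha0 n : 0 < alpha n by exact: lt_le_trans (b_alpha n).
have J_alpha n x : (J n x <= (alpha n * `|x|)%:E)%E.
  have [->|x0] := eqVneq x 0.
    by rewrite normr0 mulr0; have := JC n 0; rewrite normr0 mulr0.
  have nx : 0 < `|x| by rewrite normr_gt0.
  have -> : J n x = (`|x|%:E * J n (`|x|^-1 *: x))%E.
    rewrite /J /tail_pairing -(pairing_scale HD symE)//.
    by rewrite scalerA mulfV ?scale1r// gt_eqF.
  rewrite mulrC EFinM; apply: lee_wpmul2l => //; rewrite -alphaE.
  apply: ereal_sup_ubound; exists (`|x|^-1 *: x) => //=.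
  by rewrite normrZ ger0_norm ?invr_ge0// mulVf ?gt_eqF.
(* [c n] lies strictly below [b], hence below every [a m], so the unit ball contains elements on
   which [J n] exceeds it. *)
pose c n : R := b - n.+1%:R^-1.
have /choice[x xP] n : exists x, [/\ decreasing_cone D f x, `|x| <= 1 &
    ((c n)%:E < J n x)%E].
  have /ereal_sup_gtP[_ [x /= x1 <-] hx] : ((c n)%:E < a n)%E.
    rewrite alphaE lte_fin; apply: lt_le_trans (b_alpha n).
    by rewrite ltrBlDr ltrDl invr_gt0.
  have [z [zcone zx hz]] := tail_pairing_star HD symE y_A n x.
  by exists z; split=> //; [rewrite zx|exact: lt_le_trans hz].
have c_nd m n : (m <= n)%N -> c m <= c n.
  by move=> mn; rewrite lerD2l lerN2 lef_pV2 ?posrE// ler_nat.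
(* [q n] will bound the norm of [x n] from below, since J n (x n) > c n while [J n] has norm
   [alpha n]; its limit is b/b = 1. *)
pose q n := c n / alpha n.
have q_cvg : q n @[n --> \oo] --> (1 : R).
  rewrite -(divff (lt0r_neq0 b0)); apply: cvgM.
    rewrite -[X in _ --> X]subr0; apply: cvgB; first exact: cvg_cst.
    exact: cvg_harmonic.
  by apply: cvgV => //; exact: lt0r_neq0.
have xq n : q n <= `|x n|.
  have [_ _ h] := xP n; rewrite /q ler_pdivrMr// mulrC -lee_fin.
  exact: le_trans (ltW h) (J_alpha n (x n)).
have x_cvg : `|x n| @[n --> \oo] --> (1 : R).
  apply/cvgrPdist_le => e' e'0.
  move/cvgrPdist_le : q_cvg => /(_ _ e'0); apply: filterS => n.
  have [_ xn1 _] := xP n.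
  rewrite !ger0_norm ?subr_ge0//; last exact: le_trans (xq n) xn1.
  by apply: le_trans; rewrite lerD2l lerN2.
have [n||z hz] := rotund_cluster HD symE rotE ltr01 _ x_cvg.
- by have [] := xP n.
- move=> e' e'0; have e'1 : 0 < e' / k.+1%:R by rewrite divr_gt0.
  move/cvgrPdist_le : q_cvg => /(_ _ e'1)[N _ hN]; exists N => n Nn.
  have := hN N (leqnn N); rewrite /= ler_distl => /andP[_ qN].
  (* The sum is tested against [J N]: its index is at most every n i, so on each summand it is at
     least J (n i), hence at least [c N]. *)
  have h : k%:R * q N <= `|\sum_(i < k) x (n i)|.
    rewrite /q mulrA ler_pdivrMr// [X in _ <= X]mulrC -lee_fin.
    apply: le_trans (J_alpha N _).
    rewrite /J /tail_pairing pairing_sum//; last first.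
      by move=> i; have [xc _ _] := xP (n i); exact: cone_ge0 xc.
    have -> : ((k%:R * c N)%:E = \sum_(i < k) (c N)%:E)%E.
      by rewrite sumEFin sumr_const card_ord mulr_natl.
    apply: lee_sum => i _; apply: le_trans (J_ni _ _ _ (Nn i)).
    have [_ _ xi] := xP (n i); apply: le_trans (ltW xi).
    by rewrite lee_fin; exact: c_nd.
  rewrite mulr1; apply: le_trans h.
  rewrite lerBlDr; apply: (@le_trans _ _ (k%:R * (q N + e' / k.+1%:R))).
    by rewrite ler_peMr.
  rewrite mulrDr lerD2l mulrCA ler_piMr ?ltW//.
  by rewrite ltr_pdivrMr// mul1r ltr_nat.
(* With quarters the contradiction reads b - 1/(n+1) < J n (x n) <= C |x n - z| + J n z <= b/4 +
   b/4, while 1/(n+1) <= b/4. *)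
have b4 : 0 < b / 4%:R by rewrite divr_gt0.
have b4' : ((0 : \bar R) < (b / 4%:R)%:E)%E by rewrite lte_fin.
have [N1 hN1] := cvge_lt_eventually (J_cvg0 z) b4'.
have [N2 _ hN2] := (cvgrPdist_le _ _).1 (@cvg_harmonic R) _ b4.
have [n Nn hn] := hz (b / 4%:R / C) (divr_gt0 b4 C0) (maxn N1 N2).
have [_ _ xn] := xP n.
have h1 := hN1 n (leq_trans (leq_maxl _ _) Nn).
have := hN2 n (leq_trans (leq_maxr _ _) Nn).
rewrite /= sub0r normrN ger0_norm ?harmonic_ge0// => h2.
have h3 : (J n (x n) <= (b / 4%:R + b / 4%:R)%:E)%E.
  apply: le_trans (pairing_triangle (x n) z (mW n)) _.
  rewrite EFinD; apply: leeD; last exact: ltW.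
  apply: le_trans (JC n _) _; rewrite lee_fin mulrC -ler_pdivlMr//.
  exact: ltW.
have := lt_le_trans xn h3; rewrite lte_fin /c => h4.
have h5 : n.+1%:R^-1 <= b / 4%:R by exact: h2.
move: b0 h4 h5; clear; move: (n.+1%:R^-1 : R) => r b0 h4 h5.
by lra.
Qed.

End AssociateTheorem.

Theorem theorem5p4 (R : realType) (D : set R)
    (HD : D = `[0, 1[%classic \/ D = `[0, +oo[%classic)
    (k : nat) (hk : (2 <= k)%N)
    (E : completeNormedModType R) (f : E -> R -> \bar R)
    (symE : symmetric_space D f) (fatouE : fatou_property D f)
    (rotE : compactly_fully_rotund k (decreasing_cone D f)) :
  reflexive_space D f.
Proof.
split.
  exact: (symmetric_order_continuous HD symE rotE fatouE).
exact: (associate_order_continuous HD symE rotE fatouE).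
Qed.
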